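(* Let $k$ be an algebraically closed field and let $(X,\phi)$ be a rational dynamical system over $k$. The following are equivalent: (i) There exists a rational dynamical system $(Y,\psi)$ over $k$ with $\operatorname{adim}(X\times Y,\phi\times\psi)-\operatorname{adim}(Y,\psi)>0$. (ii) $\operatorname{adim}(X\times X,\phi\times\phi)>0$. In particular, some cartesian power of $(X,\phi)$ (that is, some $(X^n,\phi\times\cdots\times\phi)$ with $n\ge 1$) admits a nonconstant invariant rational function if and only if the second cartesian power $(X\times X,\phi\times\phi)$ does.
   Context: A rational dynamical system $(X,\phi)$ over a field $k$ is an irreducible quasi-projective variety $X$ over $k$ together with a dominant rational map $\phi:X\dashrightarrow X$ over $k$. It induces the $k$-endomorphism $\phi^*:k(X)\to k(X)$, $\phi^*(f)=f\circ\phi$. An invariant rational function of $(X,\phi)$ is an element of $\operatorname{Fix}(k(X),\phi^* )=\{f\in k(X):\phi^*(f)=f\}$; it is nonconstant if it is not in $k$. The algebraic dimension $\operatorname{adim}(X,\phi)$ is the transcendence degree of $\operatorname{Fix}(k(X),\phi^* )$ over $k$. *)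

(* Defs.v *)
From HB Require Import structures.
From mathcomp Require Import all_boot all_order all_algebra generic_quotient.
From mathcomp Require Import boolp classical_sets.
From mathcomp Require Import mpoly ring.

Set Implicit Arguments.
Unset Strict Implicit.
Unset Printing Implicit Defensive.

Import GRing.Theory.
Local Open Scope ring_scope.
Local Open Scope classical_set_scope.
Local Open Scope quotient_scope.

Section Trdeg.
Variables (k L : fieldType) (iota : {rmorphism k -> L}).

Definition alg_indep m (t : m.-tuple L) : Prop :=
  forall p : {mpoly k[m]}, mmap iota (tnth t) p = 0 -> p = 0.

Definition transcendence_basis (A : set L) m (t : m.-tuple L) : Prop :=
  [/\ forall i, A (tnth t i), alg_indep t &
      forall a, A a -> ~ alg_indep [tuple of a :: t]].

(* The number of elements of a transcendence basis of A over k.  The default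
   value 0 is only taken when A has no finite transcendence basis, which does
   not happen inside a finitely generated extension of k such as k(X). *)
Definition trdeg (A : set L) : nat :=
  xget 0%N [set m | exists t : m.-tuple L, transcendence_basis A t].

End Trdeg.

Section ProjectiveSpace.
Variable k : closedFieldType.

(* A subset of the projective space with n homogeneous coordinates (that is, of
   P^(n-1)) is represented by the set of all the nonzero vectors of k^n that are
   homogeneous coordinates of one of its points. *)

Definition zeros n (S : set {mpoly k[n]}) : set 'rV[k]_n :=
  [set x : 'rV[k]_n | x != 0 /\ forall p, S p -> p.@[x 0] = 0].

Definition zariski_closed n (Z : set 'rV[k]_n) : Prop :=
  exists2 S : set {mpoly k[n]},
    (forall p, S p -> exists d, p \is d.-homog) & Z = zeros S.

Definition locally_closed n (A : set 'rV[k]_n) : Prop :=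
  exists Z W, [/\ zariski_closed Z, zariski_closed W & A = Z `\` W].

Definition irreducible n (A : set 'rV[k]_n) : Prop :=
  A !=set0 /\
  forall Z W, zariski_closed Z -> zariski_closed W -> A `<=` Z `|` W ->
    A `<=` Z \/ A `<=` W.

(* An irreducible quasi-projective variety over the algebraically closed field
   k, given by its set of k-points. *)
Record qpvar := QPVar {
  ncoord : nat;
  points : set 'rV[k]_ncoord;
  points_locally_closed : locally_closed points;
  points_irreducible : irreducible points
}.

Arguments points : clear implicits.

Lemma meval_scale n d (p : {mpoly k[n]}) (c : k) (v : 'I_n -> k) :
  p \is d.-homog -> p.@[fun i => c * v i] = c ^+ d * p.@[v].
Proof.
move=> /dhomogP hp; rewrite !mevalE mulr_sumr !big_seq; apply: eq_bigr => m mp.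
rewrite mulrCA; congr (_ * _).
under eq_bigr do rewrite exprMn.
rewrite big_split /=; congr (_ * _).
by rewrite prodrXr -mdegE hp.
Qed.

Lemma meval_ext n (p : {mpoly k[n]}) (v w : 'I_n -> k) :
  v =1 w -> p.@[v] = p.@[w].
Proof. exact: meval_eq. Qed.

Lemma mevalZrow n d (p : {mpoly k[n]}) (c : k) (x : 'rV[k]_n) :
  p \is d.-homog -> p.@[(c *: x) 0] = c ^+ d * p.@[x 0].
Proof.
by move=> hp; rewrite -(meval_scale _ _ hp); apply: meval_ext => i; rewrite mxE.
Qed.

Lemma dhomog_comp n m d e (p : {mpoly k[n]}) (q : n.-tuple {mpoly k[m]}) :
  p \is d.-homog -> (forall i, tnth q i \is e.-homog) ->
  p \mPo q \is (e * d).-homog.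
Proof.
move=> /dhomogP hp hq; rewrite comp_mpolyE big_seq.
apply: rpred_sum => mm mp; apply: rpredZ.
rewrite -(hp _ mp) /= mdegE big_distrr /=.
elim/big_rec2: _ => [|i d' p' _ IH]; first exact: dhomog1.
by apply: dhomogM => //; apply: dhomogMn.
Qed.

Lemma meval_comp n m (p : {mpoly k[n]}) (q : n.-tuple {mpoly k[m]}) v :
  (p \mPo q).@[v] = p.@[fun i => (tnth q i).@[v]].
Proof. exact: comp_mpoly_meval. Qed.

Lemma closedP n (Z : set 'rV[k]_n) :
  zariski_closed Z <->
  (forall x, Z x -> x != 0) /\
  (forall x, x != 0 -> ~ Z x ->
     exists p d, [/\ p \is d.-homog, forall y, Z y -> p.@[y 0] = 0
                   & p.@[x 0] != 0]).
Proof.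
split=> [[S hS ->]|[Zn0 Zsep]].
  split=> [x []//|x xn0 nZ].
  have [p Sp px] : exists2 p, S p & p.@[x 0] != 0.
    apply: contrapT => h; apply: nZ; split=> // p Sp.
    by apply/eqP; apply: contrapT => /negP px; apply: h; exists p.
  have [d hd] := hS _ Sp.
  by exists p, d; split=> // y [_]; apply.
exists [set p | (exists d, p \is d.-homog) /\ forall y, Z y -> p.@[y 0] = 0].
  by move=> p [].
apply/seteqP; split=> x /= => [Zx|[xn0 hx]].
  by split; [exact: Zn0|move=> p [_]; apply].
apply: contrapT => nZ; have [p [d [hp pZ /eqP]]] := Zsep _ xn0 nZ.
by apply; apply: hx; split=> //; exists d.
Qed.

Lemma closed_neq0 n (Z : set 'rV[k]_n) x : zariski_closed Z -> Z x -> x != 0.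
Proof. by move=> /closedP[h _]; apply: h. Qed.

Lemma closed_scale n (Z : set 'rV[k]_n) (c : k) x :
  zariski_closed Z -> c != 0 -> Z x -> Z (c *: x).
Proof.
move=> [S hS ->] c0 [xn0 hx]; split.
  by rewrite scaler_eq0 negb_or c0.
by move=> p Sp; have [d hd] := hS _ Sp; rewrite (mevalZrow _ _ hd) hx // mulr0.
Qed.

Lemma closedV n d (p : {mpoly k[n]}) : p \is d.-homog ->
  zariski_closed [set x : 'rV[k]_(_) | x != 0 /\ p.@[x 0] = 0].
Proof.
move=> hp; exists [set p]; first by move=> _ ->; exists d.
by apply/seteqP; split=> x [? h]; split=> //; [move=> _ ->|exact: h].
Qed.

Lemma closedU n (Z W : set 'rV[k]_n) :
  zariski_closed Z -> zariski_closed W -> zariski_closed (Z `|` W).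
Proof.
move=> /closedP[Z0 ZP] /closedP[W0 WP]; apply/closedP; split.
  by move=> x [/Z0|/W0].
move=> x xn0 /not_orP[nZ nW].
have [p [d [hp pZ px]]] := ZP _ xn0 nZ; have [q [e [hq qW qx]]] := WP _ xn0 nW.
exists (p * q), (d + e)%N; split.
- exact: dhomogM.
- by move=> y [/pZ|/qW] h; rewrite mevalM h ?mul0r ?mulr0.
- by rewrite mevalM mulf_neq0.
Qed.

Lemma closedn0 n : zariski_closed [set x : 'rV[k]_n | x != 0].
Proof. by apply/closedP; split=> // x xn0 []. Qed.

Lemma qpvar_neq0 (X : qpvar) x : points X x -> x != 0.
Proof.
have [Z [W [cZ _ ->]]] := points_locally_closed X.
by move=> [Zx _]; apply: closed_neq0 Zx.
Qed.

Lemma qpvar_scale (X : qpvar) (c : k) x : c != 0 -> points X x -> points X (c *: x).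
Proof.
have [Z [W [cZ cW ->]]] := points_locally_closed X => c0 [Zx Wx]; split.
  exact: closed_scale.
move=> Wcx; apply: Wx; rewrite -[x]scale1r -(mulVf c0) -scalerA.
by apply: closed_scale; rewrite ?invr_eq0.
Qed.

Lemma qpvar_irr (X : qpvar) Z W : zariski_closed Z -> zariski_closed W ->
  ~ points X `<=` Z -> ~ points X `<=` W -> exists x, [/\ points X x, ~ Z x & ~ W x].
Proof.
move=> cZ cW nZ nW; apply: contrapT => h.
have [_ /(_ Z W cZ cW)] := points_irreducible X.
case=> // x Xx; apply: contrapT => /not_orP[Zx Wx].
by apply: h; exists x.
Qed.

Definition nonvanishing (X : qpvar) (p : {mpoly k[ncoord X]}) : Prop :=
  exists2 x, points X x & p.@[x 0] != 0.

Lemma nonvanishingP (X : qpvar) (p : {mpoly k[ncoord X]}) :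
  nonvanishing p <-> ~ points X `<=` [set x : 'rV[k]_(_) | x != 0 /\ p.@[x 0] = 0].
Proof.
split=> [[x Xx /eqP px] h|h]; first by apply: px; case: (h _ Xx).
apply: contrapT => h'; apply: h => x Xx /=; split; first exact: qpvar_neq0.
by apply/eqP; apply: contrapT => /negP px; apply: h'; exists x.
Qed.

Lemma nonvanishingW (X : qpvar) d (p : {mpoly k[ncoord X]}) W :
  p \is d.-homog -> zariski_closed W -> nonvanishing p -> ~ points X `<=` W ->
  exists x, [/\ points X x, p.@[x 0] != 0 & ~ W x].
Proof.
move=> hp cW /nonvanishingP np nW.
have [x [Xx npx nWx]] := qpvar_irr (closedV hp) cW np nW.
exists x; split=> //; apply/eqP => px; apply: npx.
by split=> //; apply: qpvar_neq0.
Qed.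

Lemma nonvanishingM (X : qpvar) d e (p q : {mpoly k[ncoord X]}) :
  p \is d.-homog -> q \is e.-homog ->
  nonvanishing p -> nonvanishing q -> nonvanishing (p * q).
Proof.
move=> hp hq np /nonvanishingP nq.
have [x [Xx px Wx]] := nonvanishingW hp (closedV hq) np nq.
exists x => //; rewrite mevalM mulf_neq0 //; apply/eqP => qx; apply: Wx.
by split=> //; apply: qpvar_neq0.
Qed.

Section Segre.
Variables n m : nat.

(* homogeneous coordinates z_(i,j) = x_i * y_j, in the order of mxvec *)
Definition segre (x : 'rV[k]_n) (y : 'rV[k]_m) : 'rV[k]_(n * m) :=
  mxvec (x^T *m y).

Lemma segreE x y i j : segre x y 0 (mxvec_index i j) = x 0 i * y 0 j.
Proof. by rewrite mxvecE mxE big_ord1 mxE. Qed.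

Lemma rV_neq0P p (x : 'rV[k]_p) : reflect (exists i, x 0 i != 0) (x != 0).
Proof.
apply: (iffP idP) => [xn0|[i xi]]; last first.
  by apply: contraNneq xi => ->; rewrite mxE.
apply: contrapT => h; move/eqP: xn0; apply; apply/rowP => i; rewrite mxE.
by apply/eqP; apply: contrapT => /negP xi; apply: h; exists i.
Qed.

Lemma segre_neq0 x y : x != 0 -> y != 0 -> segre x y != 0.
Proof.
move=> /rV_neq0P[i xi] /rV_neq0P[j yj]; apply/rV_neq0P.
by exists (mxvec_index i j); rewrite segreE mulf_neq0.
Qed.

Lemma segre_neq0l x y : segre x y != 0 -> x != 0.
Proof.
apply: contraNneq => ->.
by apply/eqP; apply/rowP => l; case/mxvec_indexP: l => i j; rewrite segreE !mxE mul0r.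
Qed.

Lemma segre_neq0r x y : segre x y != 0 -> y != 0.
Proof.
apply: contraNneq => ->.
by apply/eqP; apply/rowP => l; case/mxvec_indexP: l => i j; rewrite segreE !mxE mulr0.
Qed.

Lemma segreZl c x y : segre (c *: x) y = c *: segre x y.
Proof.
by apply/rowP => l; case/mxvec_indexP: l => i j; rewrite mxE !segreE mxE mulrA.
Qed.

Lemma segre_inj x y x' y' : segre x y = segre x' y' -> x != 0 -> y != 0 ->
  exists c d, [/\ c != 0, d != 0, x = c *: x' & y = d *: y'].
Proof.
move=> e /rV_neq0P[a xa] /rV_neq0P[b yb].
have h i j : x 0 i * y 0 j = x' 0 i * y' 0 j by rewrite -!segreE e.
have := mulf_neq0 xa yb; rewrite h mulf_eq0 negb_or => /andP[xa' yb'].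
exists (y' 0 b / y 0 b), (x' 0 a / x 0 a); split.
- by rewrite mulf_neq0 ?invr_eq0.
- by rewrite mulf_neq0 ?invr_eq0.
- by apply/rowP => i; rewrite mxE mulrAC [y' _ _ * _]mulrC -h mulfK.
- by apply/rowP => j; rewrite mxE mulrAC -h mulrAC divff // mul1r.
Qed.

Definition segre_col (b : 'I_m) : n.-tuple {mpoly k[n * m]} :=
  [tuple 'X_(mxvec_index i b) | i < n].
Definition segre_row (a : 'I_n) : m.-tuple {mpoly k[n * m]} :=
  [tuple 'X_(mxvec_index a j) | j < m].

Lemma dhomogC p (c : k) : (c%:MP : {mpoly k[p]}) \is 0.-homog.
Proof. by rewrite -[c%:MP]mulr1 mul_mpolyC rpredZ // dhomog1. Qed.

Lemma dhomog_var p (i : 'I_p) : ('X_i : {mpoly k[p]}) \is 1.-homog.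
Proof. by rewrite dhomogX /= mdeg1. Qed.

Lemma segre_col_homog b i : tnth (segre_col b) i \is 1.-homog.
Proof. by rewrite tnth_mktuple dhomog_var. Qed.

Lemma segre_row_homog a j : tnth (segre_row a) j \is 1.-homog.
Proof. by rewrite tnth_mktuple dhomog_var. Qed.

Lemma meval_segre_col d (p : {mpoly k[n]}) b x y : p \is d.-homog ->
  (p \mPo segre_col b).@[segre x y 0] = y 0 b ^+ d * p.@[x 0].
Proof.
move=> hp; rewrite meval_comp -(meval_scale _ _ hp); apply: meval_ext => i.
by rewrite tnth_mktuple mevalXU segreE mulrC.
Qed.

Lemma meval_segre_row d (p : {mpoly k[m]}) a x y : p \is d.-homog ->
  (p \mPo segre_row a).@[segre x y 0] = x 0 a ^+ d * p.@[y 0].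
Proof.
move=> hp; rewrite meval_comp -(meval_scale _ _ hp); apply: meval_ext => i.
by rewrite tnth_mktuple mevalXU segreE.
Qed.

Lemma homog_segre_col d (p : {mpoly k[n]}) b : p \is d.-homog ->
  p \mPo segre_col b \is d.-homog.
Proof.
by move=> hp; rewrite -[d]mul1n; apply: dhomog_comp => // i; apply: segre_col_homog.
Qed.

Lemma homog_segre_row d (p : {mpoly k[m]}) a : p \is d.-homog ->
  p \mPo segre_row a \is d.-homog.
Proof.
by move=> hp; rewrite -[d]mul1n; apply: dhomog_comp => // i; apply: segre_row_homog.
Qed.

Definition prod_points (A : set 'rV[k]_n) (B : set 'rV[k]_m) :
  set 'rV[k]_(n * m) := [set segre p.1 p.2 | p in A `*` B].

Lemma closed_prod A B : zariski_closed A -> zariski_closed B ->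
  zariski_closed (prod_points A B).
Proof.
move=> cA cB; have [A0 AP] := (closedP A).1 cA; have [B0 BP] := (closedP B).1 cB.
apply/closedP; split=> [_ [[x y] /= [Ax By] <-]|z zn0 nz].
  by apply: segre_neq0; [apply: A0|apply: B0].
have [r|] := pselect (forall i j i' j', z 0 (mxvec_index i j) * z 0 (mxvec_index i' j')
   = z 0 (mxvec_index i j') * z 0 (mxvec_index i' j)); last first.
  move=> /existsNP[i /existsNP[j /existsNP[i' /existsNP[j' /eqP h]]]].
  exists ('X_(mxvec_index i j) * 'X_(mxvec_index i' j')
          - 'X_(mxvec_index i j') * 'X_(mxvec_index i' j)), 2%N; split.
  - by rewrite -[2%N]/(1 + 1)%N rpredB // dhomogM // dhomog_var.
  - move=> _ [[x y] /= [Ax By] <-]; rewrite mevalB !mevalM !mevalXU !segreE.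
    by apply/eqP; rewrite subr_eq0; apply/eqP; ring.
  - by rewrite mevalB !mevalM !mevalXU subr_eq0.
have /rV_neq0P[l] := zn0; case/mxvec_indexP: l => a b zab.
pose x := \row_i z 0 (mxvec_index i b); pose y := \row_j z 0 (mxvec_index a j).
have ez : z = (z 0 (mxvec_index a b))^-1 *: segre x y.
  apply/rowP => l; case/mxvec_indexP: l => i j.
  by rewrite mxE segreE !mxE r mulrC mulfK.
have xn0 : x != 0 by apply/rV_neq0P; exists a; rewrite mxE.
have yn0 : y != 0 by apply/rV_neq0P; exists b; rewrite mxE.
have [Ax|nAx] := pselect (A x).
  have nBy : ~ B y.
    move=> By; apply: nz; exists ((z 0 (mxvec_index a b))^-1 *: x, y) => /=.
      by split=> //=; apply: closed_scale; rewrite ?invr_eq0.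
    by rewrite segreZl -ez.
  have [p [d [hp pB py]]] := BP _ yn0 nBy.
  exists (p \mPo segre_row a), d; split; first exact: homog_segre_row.
  - move=> _ [[x' y'] /= [Ax' By'] <-].
    by rewrite (meval_segre_row _ _ _ hp) pB // mulr0.
  - rewrite meval_comp; congr (_ != 0): py; apply: meval_ext => i.
    by rewrite tnth_mktuple mevalXU mxE.
have [p [d [hp pB py]]] := AP _ xn0 nAx.
exists (p \mPo segre_col b), d; split; first exact: homog_segre_col.
- move=> _ [[x' y'] /= [Ax' By'] <-].
  by rewrite (meval_segre_col _ _ _ hp) pB // mulr0.
- rewrite meval_comp; congr (_ != 0): py; apply: meval_ext => i.
  by rewrite tnth_mktuple mevalXU mxE.
Qed.

Lemma locally_closed_prod A B : locally_closed A -> locally_closed B ->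
  locally_closed (prod_points A B).
Proof.
move=> [Z1 [W1 [cZ1 cW1 ->]]] [Z2 [W2 [cZ2 cW2 ->]]].
exists (prod_points Z1 Z2), (prod_points W1 [set y : 'rV[k]_m | y != 0]
  `|` prod_points [set x : 'rV[k]_n | x != 0] W2); split.
- exact: closed_prod.
- by apply: closedU; apply: closed_prod => //; apply: closedn0.
- apply/seteqP; split.
    move=> _ [[x y] /= [[Zx Wx] [Zy Wy]] <-]; split; first by exists (x, y).
    have xn0 := closed_neq0 cZ1 Zx; have yn0 := closed_neq0 cZ2 Zy.
    case=> -[[x' y'] /= [h1 h2]] /esym/segre_inj-/(_ xn0 yn0)[c [d [c0 d0 ex ey]]].
      by apply: Wx; rewrite ex; apply: closed_scale.
    by apply: Wy; rewrite ey; apply: closed_scale.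
  move=> _ [[[x y] /= [Zx Zy] <-]] /not_orP[h1 h2].
  have xn0 := closed_neq0 cZ1 Zx; have yn0 := closed_neq0 cZ2 Zy.
  exists (x, y) => //; split; split=> //= ?.
    by apply: h1; exists (x, y).
  by apply: h2; exists (x, y).
Qed.

Lemma closed_slicel Z y : zariski_closed Z -> y != 0 ->
  zariski_closed [set x | Z (segre x y)].
Proof.
move=> cZ yn0; have [Z0 ZP] := (closedP Z).1 cZ.
apply/closedP; split=> [x /Z0/segre_neq0l//|x xn0 nZ].
have [p [d [hp pZ px]]] := ZP _ (segre_neq0 xn0 yn0) nZ.
pose q : (n * m).-tuple {mpoly k[n]} :=
  [tuple mxvec (\matrix_(i < n, j < m) (y 0 j *: 'X_i : {mpoly k[n]})) 0 l | l < n * m].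
have e (x' : 'rV[k]_n) : (p \mPo q).@[x' 0] = p.@[segre x' y 0].
  rewrite meval_comp; apply: meval_ext => l; rewrite tnth_mktuple.
  by case/mxvec_indexP: l => i j; rewrite segreE mxvecE mxE mevalZ mevalXU mulrC.
exists (p \mPo q), d; split.
- rewrite -[d]mul1n; apply: dhomog_comp => // l; rewrite tnth_mktuple.
  by case/mxvec_indexP: l => i j; rewrite mxvecE mxE rpredZ // dhomog_var.
- by move=> x' /pZ; rewrite e.
- by rewrite e.
Qed.

Lemma closed_slicer Z x : zariski_closed Z -> x != 0 ->
  zariski_closed [set y | Z (segre x y)].
Proof.
move=> cZ xn0; have [Z0 ZP] := (closedP Z).1 cZ.
apply/closedP; split=> [y /Z0/segre_neq0r//|y yn0 nZ].
have [p [d [hp pZ px]]] := ZP _ (segre_neq0 xn0 yn0) nZ.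
pose q : (n * m).-tuple {mpoly k[m]} :=
  [tuple mxvec (\matrix_(i < n, j < m) (x 0 i *: 'X_j : {mpoly k[m]})) 0 l | l < n * m].
have e (y' : 'rV[k]_m) : (p \mPo q).@[y' 0] = p.@[segre x y' 0].
  rewrite meval_comp; apply: meval_ext => l; rewrite tnth_mktuple.
  by case/mxvec_indexP: l => i j; rewrite segreE mxvecE mxE mevalZ mevalXU.
exists (p \mPo q), d; split.
- rewrite -[d]mul1n; apply: dhomog_comp => // l; rewrite tnth_mktuple.
  by case/mxvec_indexP: l => i j; rewrite mxvecE mxE rpredZ // dhomog_var.
- by move=> y' /pZ; rewrite e.
- by rewrite e.
Qed.

End Segre.

Lemma irreducible_prod (X Y : qpvar) :
  irreducible (prod_points (points X) (points Y)).
Proof.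
have [[[x0 Xx0] _] [[y0 Yy0] _]] := (points_irreducible X, points_irreducible Y).
split; first by exists (segre x0 y0), (x0, y0).
move=> Z W cZ cW h.
pose sl (Z : set 'rV[k]_(ncoord X * ncoord Y)) :=
  [set y : 'rV[k]_(ncoord Y) | y != 0 /\ forall x, points X x -> Z (segre x y)].
have csl V : zariski_closed V -> zariski_closed (sl V).
  move=> cV; apply/closedP; split=> [y []//|y yn0 ny].
  have [x Xx nV] : exists2 x, points X x & ~ V (segre x y).
    apply: contrapT => h'; apply: ny; split=> // x Xx.
    by apply: contrapT => ?; apply: h'; exists x.
  have [_ /(_ y yn0 nV)[p [d [hp pV py]]]] :=
    (closedP _).1 (closed_slicer cV (qpvar_neq0 Xx)).
  by exists p, d; split=> // y' [_ /(_ _ Xx)]; apply: pV.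
have [_ irY] := points_irreducible Y; have [_ irX] := points_irreducible X.
have : points Y `<=` sl Z `|` sl W.
  move=> y Yy; have yn0 := qpvar_neq0 Yy.
  have [] := irX _ _ (closed_slicel cZ yn0) (closed_slicel cW yn0).
  - by move=> x Xx; apply: h; exists (x, y).
  - by move=> hZ; left; split.
  - by move=> hW; right; split.
by case/(irY _ _ (csl _ cZ) (csl _ cW)) => b; [left|right];
  move=> _ [[x y] [/= Xx Yy] <-]; apply: (b _ Yy).2.
Qed.

Definition prod_var (X Y : qpvar) : qpvar :=
  QPVar (locally_closed_prod (points_locally_closed X) (points_locally_closed Y))
        (irreducible_prod X Y).

Section RatMap.
Variables X Y : qpvar.

Definition rmap_eval (F : (ncoord Y).-tuple {mpoly k[ncoord X]})
    (x : 'rV[k]_(ncoord X)) : 'rV[k]_(ncoord Y) :=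
  \row_j (tnth F j).@[x 0].

(* A rational map from X to Y is represented by a tuple of forms of the same
   degree in the homogeneous coordinates of X, mapping some nonempty open subset
   of X into Y.  Two tuples F and G represent the same rational map when the
   forms F_i * G_j - F_j * G_i vanish on X; all the notions below only depend on
   the rational map.  Note that rmap_eval F x = 0, which is not a point of Y,
   when all the forms vanish at x. *)
Definition is_ratmap (F : (ncoord Y).-tuple {mpoly k[ncoord X]}) : Prop :=
  (exists d, forall j, tnth F j \is d.-homog) /\
  (exists W, [/\ zariski_closed W, ~ points X `<=` W &
     forall x, points X x -> ~ W x -> points Y (rmap_eval F x)]).

Definition is_dominant (F : (ncoord Y).-tuple {mpoly k[ncoord X]}) : Prop :=
  forall Z, zariski_closed Z ->
    (forall x, points X x -> points Y (rmap_eval F x) -> Z (rmap_eval F x)) ->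
    points Y `<=` Z.

Record dratmap := DRatMap {
  rforms : (ncoord Y).-tuple {mpoly k[ncoord X]};
  dratmap_ratmap : is_ratmap rforms;
  dratmap_dominant : is_dominant rforms
}.

Lemma meval_rmap (F : (ncoord Y).-tuple {mpoly k[ncoord X]}) p (x : 'rV[k]_(ncoord X)) :
  (p \mPo F).@[x 0] = p.@[rmap_eval F x 0].
Proof. by rewrite meval_comp; apply: meval_ext => i; rewrite mxE. Qed.

Lemma dominantW (f : dratmap) Z W :
  zariski_closed Z -> zariski_closed W -> ~ points X `<=` W ->
  (forall x, points X x -> ~ W x -> points Y (rmap_eval (rforms f) x) ->
     Z (rmap_eval (rforms f) x)) ->
  points Y `<=` Z.
Proof.
case: f => /= F [[d hF] [U [cU nU FU]]] dom cZ cW nW h.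
apply: dom => // x Xx YFx.
case: cZ h => S hS -> h; split=> [|p Sp]; first exact: qpvar_neq0 YFx.
have [e hp] := hS _ Sp.
have hpF : p \mPo F \is (d * e).-homog by apply: dhomog_comp.
apply: contrapT => /eqP px.
have np : @nonvanishing X (p \mPo F) by exists x => //; rewrite meval_rmap.
have nUW : ~ points X `<=` U `|` W.
  by move=> /((points_irreducible X).2 _ _ cU cW)[].
have [y [Xy py /not_orP[Uy Wy]]] := nonvanishingW hpF (closedU cU cW) np nUW.
move/eqP: py; apply; rewrite meval_rmap.
by rewrite (h _ Xy Wy (FU _ Xy Uy)).2.
Qed.

Lemma nonvanishing_pull (f : dratmap) d p : p \is d.-homog ->
  @nonvanishing Y p -> @nonvanishing X (p \mPo rforms f).
Proof.
move=> hp /nonvanishingP np; apply: contrapT => h; apply: np.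
apply: (dratmap_dominant (d := f) (closedV hp)) => x Xx YFx.
split; first exact: qpvar_neq0 YFx.
apply/eqP; apply: contrapT => /negP px; apply: h; exists x => //.
by rewrite meval_rmap.
Qed.

End RatMap.

Lemma coord_exists (X : qpvar) : exists a, @nonvanishing X 'X_a.
Proof.
have [[x Xx] _] := points_irreducible X.
have /rV_neq0P[a xa] := qpvar_neq0 Xx.
by exists a, x; rewrite ?mevalXU.
Qed.

Definition coord (X : qpvar) : 'I_(ncoord X) := projT1 (cid (coord_exists X)).

Lemma coordP (X : qpvar) : @nonvanishing X 'X_(coord X).
Proof. by rewrite /coord; case: cid. Qed.

Section ProdMap.
Variables (X Y X' Y' : qpvar) (f : dratmap X X') (g : dratmap Y Y').

Let a := coord X.
Let b := coord Y.

(* At the point z_(i,j) = x_i * y_j, the column b of z represents x and its row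
   a represents y, so the forms F_i(z_(.,b)) * G_j(z_(a,.)) represent
   (x, y) |-> (F(x), G(y)), as long as x_a and y_b are nonzero
   (see prod_mapE below). *)
Definition prod_forms :
    (ncoord (prod_var X' Y')).-tuple {mpoly k[ncoord (prod_var X Y)]} :=
  [tuple mxvec (\matrix_(i < ncoord X', j < ncoord Y')
     ((tnth (rforms f) i \mPo segre_col (ncoord X) b) *
      (tnth (rforms g) j \mPo segre_row (ncoord Y) a))) 0 l
   | l < ncoord X' * ncoord Y'].

Lemma prod_mapE d e x y : (forall i, tnth (rforms f) i \is d.-homog) ->
  (forall j, tnth (rforms g) j \is e.-homog) ->
  @rmap_eval (prod_var X Y) (prod_var X' Y') prod_forms (segre x y) =
  (y 0 b ^+ d * x 0 a ^+ e) *: segre (rmap_eval (rforms f) x) (rmap_eval (rforms g) y).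
Proof.
move=> hf hg; apply/rowP => l; case/mxvec_indexP: l => i j.
rewrite !mxE segreE !mxE tnth_mktuple mxvecE mxE mevalM.
rewrite (meval_segre_col _ _ _ (hf i)) (meval_segre_row _ _ _ (hg j)).
by rewrite mulrACA.
Qed.

Lemma prod_ratmap : @is_ratmap (prod_var X Y) (prod_var X' Y') prod_forms.
Proof.
have [[d hf] [U [cU nU fU]]] := dratmap_ratmap f.
have [[e hg] [V [cV nV gV]]] := dratmap_ratmap g.
split.
  exists (d + e)%N => l; rewrite tnth_mktuple; case/mxvec_indexP: l => i j.
  rewrite mxvecE mxE dhomogM //.
    exact: homog_segre_col.
  exact: homog_segre_row.
pose Va := [set x : 'rV[k]_(ncoord X) | x != 0 /\ ('X_a : {mpoly k[_]}).@[x 0] = 0].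
pose Vb := [set y : 'rV[k]_(ncoord Y) | y != 0 /\ ('X_b : {mpoly k[_]}).@[y 0] = 0].
have cVa : zariski_closed Va by apply: closedV (dhomog_var a).
have cVb : zariski_closed Vb by apply: closedV (dhomog_var b).
exists (prod_points (U `|` Va) [set y : 'rV[k]_(ncoord Y) | y != 0] `|`
        prod_points [set x : 'rV[k]_(ncoord X) | x != 0] (V `|` Vb)); split.
- by apply: closedU; apply: closed_prod; try exact: closedn0; exact: closedU.
- have [x [Xx Ux ax]] := qpvar_irr cU cVa nU ((nonvanishingP _).1 (coordP X)).
  have [y [Yy Vy by_]] := qpvar_irr cV cVb nV ((nonvanishingP _).1 (coordP Y)).
  have xn0 := qpvar_neq0 Xx; have yn0 := qpvar_neq0 Yy.
  move=> /(_ (segre x y))[]; first by exists (x, y).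
    move=> [[x' y'] /= [h _]] /esym/segre_inj-/(_ xn0 yn0)[c [? [c0 _ ex _]]].
    have [] : (U `|` Va) x by rewrite ex; apply: closed_scale => //; apply: closedU.
      by [].
    by [].
  move=> [[x' y'] /= [_ h]] /esym/segre_inj-/(_ xn0 yn0)[? [c [_ c0 _ ey]]].
  have [] : (V `|` Vb) y by rewrite ey; apply: closed_scale => //; apply: closedU.
    by [].
  by [].
- move=> _ [[x y] /= [Xx Yy] <-] /not_orP[h1 h2].
  have xn0 := qpvar_neq0 Xx; have yn0 := qpvar_neq0 Yy.
  have /not_orP[Ux ax] : ~ (U `|` Va) x by move=> h; apply: h1; exists (x, y).
  have /not_orP[Vy by_] : ~ (V `|` Vb) y by move=> h; apply: h2; exists (x, y).
  have xa : x 0 a != 0.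
    by apply/eqP => e0; apply: ax; split=> //; rewrite mevalXU.
  have yb : y 0 b != 0.
    by apply/eqP => e0; apply: by_; split=> //; rewrite mevalXU.
  rewrite (prod_mapE _ _ hf hg); apply: (@qpvar_scale (prod_var X' Y')).
    by rewrite mulf_neq0 ?expf_neq0.
  by exists (rmap_eval (rforms f) x, rmap_eval (rforms g) y) => //=; split;
    [apply: fU|apply: gV].
Qed.

Lemma prod_dominant : @is_dominant (prod_var X Y) (prod_var X' Y') prod_forms.
Proof.
move=> Z cZ hZ.
have [[d hf] _] := dratmap_ratmap f; have [[e hg] _] := dratmap_ratmap g.
pose Va := [set x : 'rV[k]_(ncoord X) | x != 0 /\ ('X_a : {mpoly k[_]}).@[x 0] = 0].
pose Vb := [set y : 'rV[k]_(ncoord Y) | y != 0 /\ ('X_b : {mpoly k[_]}).@[y 0] = 0].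
have cVa : zariski_closed Va by apply: closedV (dhomog_var a).
have cVb : zariski_closed Vb by apply: closedV (dhomog_var b).
have nVa := (nonvanishingP _).1 (coordP X).
have nVb := (nonvanishingP _).1 (coordP Y).
have key x y : points X x -> ~ Va x -> points Y y -> ~ Vb y ->
    points X' (rmap_eval (rforms f) x) -> points Y' (rmap_eval (rforms g) y) ->
    Z (segre (rmap_eval (rforms f) x) (rmap_eval (rforms g) y)).
  move=> Xx ax Yy by_ Xfx Ygy.
  have xa : x 0 a != 0.
    by apply/eqP => e0; apply: ax; split; [exact: qpvar_neq0|rewrite mevalXU].
  have yb : y 0 b != 0.
    by apply/eqP => e0; apply: by_; split; [exact: qpvar_neq0|rewrite mevalXU].
  set c := y 0 b ^+ d * x 0 a ^+ e.
  have c0 : c != 0 by rewrite mulf_neq0 ?expf_neq0.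
  rewrite -[X in Z X]scale1r -(mulVf c0) -scalerA -(prod_mapE _ _ hf hg).
  apply: closed_scale; rewrite ?invr_eq0 //; apply: hZ.
    by exists (x, y).
  rewrite (prod_mapE _ _ hf hg); apply: (@qpvar_scale (prod_var X' Y')) => //.
  by exists (rmap_eval (rforms f) x, rmap_eval (rforms g) y).
move=> _ [[x' y'] /= [Xx' Yy'] <-].
have xn0 := qpvar_neq0 Xx'.
apply: (dominantW (f := g) (closed_slicer cZ xn0) cVb nVb _ Yy') => y Yy by_ Ygy /=.
have yn0 := qpvar_neq0 Ygy.
apply: (dominantW (f := f) (closed_slicel cZ yn0) cVa nVa _ Xx') => x Xx ax Xfx /=.
exact: key.
Qed.

Definition prod_map : dratmap (prod_var X Y) (prod_var X' Y') :=
  DRatMap prod_ratmap prod_dominant.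

End ProdMap.

Section FunctionField.
Variable X : qpvar.
Let R := {mpoly k[ncoord X]}.

(* k(X) is the set ratfun of the quotients P/Q of two forms of the same degree
   with Q not vanishing identically on X, where P/Q = P'/Q' when P * Q' - P' * Q
   vanishes on X. *)
Record hfrac := HFrac {
  hnum : R;
  hden : R;
  hfrac_homog : exists d, hnum \is d.-homog /\ hden \is d.-homog;
  hden_nv : nonvanishing hden
}.

HB.instance Definition _ := gen_eqMixin hfrac.
HB.instance Definition _ := gen_choiceMixin hfrac.

Definition hfrac_eq (p q : hfrac) : bool :=
  `[< forall x, points X x ->
        (hnum p * hden q).@[x 0] = (hnum q * hden p).@[x 0] >].

Lemma hfrac_eqP (p q : hfrac) :
  reflect (forall x, points X x ->
             (hnum p).@[x 0] * (hden q).@[x 0] = (hnum q).@[x 0] * (hden p).@[x 0])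
          (hfrac_eq p q).
Proof.
by apply: (iffP (asboolP _)) => h x Xx; have := h x Xx; rewrite !mevalM.
Qed.

Lemma vanish_cancel d e (p q : R) : p \is d.-homog -> q \is e.-homog ->
  nonvanishing q -> (forall x, points X x -> p.@[x 0] * q.@[x 0] = 0) ->
  forall x, points X x -> p.@[x 0] = 0.
Proof.
move=> hp hq nq h x Xx; apply: contrapT => /eqP px.
have [y Xy /eqP] : nonvanishing (p * q).
  by apply: nonvanishingM hp hq _ nq; exists x.
by apply; rewrite mevalM h.
Qed.

Lemma hfrac_eq_refl : reflexive hfrac_eq.
Proof. by move=> p; apply/hfrac_eqP. Qed.

Lemma hfrac_eq_sym : ssrbool.symmetric hfrac_eq.
Proof. by move=> p q; apply/hfrac_eqP/hfrac_eqP => h x Xx; rewrite h. Qed.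

Lemma hfrac_eq_trans : ssrbool.transitive hfrac_eq.
Proof.
move=> q p r /hfrac_eqP hpq /hfrac_eqP hqr; apply/hfrac_eqP => x Xx.
have [d [np dp]] := hfrac_homog p; have [e [nq dq]] := hfrac_homog q.
have [f [nr dr]] := hfrac_homog r.
have hh : hnum p * hden r - hnum r * hden p \is (d + f).-homog.
  by apply: rpredB; [|rewrite addnC]; apply: dhomogM.
apply/eqP; rewrite -subr_eq0 -!mevalM -mevalB; apply/eqP.
apply: (vanish_cancel hh dq (hden_nv q)) Xx => y Xy.
by rewrite mevalB !mevalM; ring: (hpq _ Xy) (hqr _ Xy).
Qed.

Canonical hfrac_equiv :=
  EquivRel hfrac_eq hfrac_eq_refl hfrac_eq_sym hfrac_eq_trans.

Definition ratfun := {eq_quot hfrac_eq}.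

HB.instance Definition _ : EqQuotient _ hfrac_eq ratfun := EqQuotient.on ratfun.
HB.instance Definition _ := Choice.on ratfun.

Lemma ratfun_eqP (p q : hfrac) :
  \pi_ratfun p = \pi_ratfun q <->
  (forall x, points X x ->
    (hnum p).@[x 0] * (hden q).@[x 0] = (hnum q).@[x 0] * (hden p).@[x 0]).
Proof. by split=> [/eqmodP/hfrac_eqP|/hfrac_eqP/eqmodP]. Qed.

Lemma hrepr_eq (p : hfrac) x : points X x ->
  (hnum (repr (\pi_ratfun p))).@[x 0] * (hden p).@[x 0] =
  (hnum p).@[x 0] * (hden (repr (\pi_ratfun p))).@[x 0].
Proof.
have /ratfun_eqP h : \pi_ratfun (repr (\pi_ratfun p)) = \pi_ratfun p by rewrite reprK.
exact: h.
Qed.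

Lemma nonvanishing1 : nonvanishing (1 : R).
Proof.
by have [[x Xx] _] := points_irreducible X; exists x; rewrite // meval1 oner_neq0.
Qed.

Definition hconst (c : k) : hfrac.
Proof.
refine (@HFrac c%:MP 1 _ nonvanishing1).
by exists 0%N; split; [exact: dhomogC|exact: dhomog1].
Defined.

Definition hadd (p q : hfrac) : hfrac.
Proof.
refine (@HFrac (hnum p * hden q + hnum q * hden p) (hden p * hden q) _ _).
  have [d [np dp]] := hfrac_homog p; have [e [nq dq]] := hfrac_homog q.
  exists (d + e)%N; split; last exact: dhomogM.
  by apply: rpredD; [|rewrite [(d + e)%N]addnC]; apply: dhomogM.
have [d [_ dp]] := hfrac_homog p; have [e [_ dq]] := hfrac_homog q.
exact: nonvanishingM dp dq (hden_nv p) (hden_nv q).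
Defined.

Definition hopp (p : hfrac) : hfrac.
Proof.
refine (@HFrac (- hnum p) (hden p) _ (hden_nv p)).
by have [d [np dp]] := hfrac_homog p; exists d; rewrite rpredN.
Defined.

Definition hmul (p q : hfrac) : hfrac.
Proof.
refine (@HFrac (hnum p * hnum q) (hden p * hden q) _ _).
  have [d [np dp]] := hfrac_homog p; have [e [nq dq]] := hfrac_homog q.
  by exists (d + e)%N; split; apply: dhomogM.
have [d [_ dp]] := hfrac_homog p; have [e [_ dq]] := hfrac_homog q.
exact: nonvanishingM dp dq (hden_nv p) (hden_nv q).
Defined.

Definition hinv (p : hfrac) : hfrac.
Proof.
refine (if pselect (nonvanishing (hnum p)) is left np
        then @HFrac (hden p) (hnum p) _ np else hconst 0).
by have [d [? ?]] := hfrac_homog p; exists d.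
Defined.

Definition rzero : ratfun := \pi_ratfun (hconst 0).
Definition rone : ratfun := \pi_ratfun (hconst 1).
Definition radd := lift_op2 ratfun hadd.
Definition ropp := lift_op1 ratfun hopp.
Definition rmul := lift_op2 ratfun hmul.
Definition rinv := lift_op1 ratfun hinv.

Lemma radd_pi p q : radd (\pi_ratfun p) (\pi_ratfun q) = \pi_ratfun (hadd p q).
Proof.
unlock radd; apply/ratfun_eqP => x Xx /=; rewrite !(mevalM, mevalD).
have := hrepr_eq p Xx; have := hrepr_eq q Xx.
set a := (hnum p).@[_]; set b := (hden p).@[_].
set c := (hnum q).@[_]; set d := (hden q).@[_].
set a' := (hnum _).@[_]; set b' := (hden _).@[_].
set c' := (hnum _).@[_]; set d' := (hden _).@[_] => h1 h2.
by ring: h1 h2.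
Qed.

Lemma ropp_pi p : ropp (\pi_ratfun p) = \pi_ratfun (hopp p).
Proof.
unlock ropp; apply/ratfun_eqP => x Xx /=; rewrite !mevalN !mulNr.
by rewrite (hrepr_eq p Xx).
Qed.

Lemma rmul_pi p q : rmul (\pi_ratfun p) (\pi_ratfun q) = \pi_ratfun (hmul p q).
Proof.
unlock rmul; apply/ratfun_eqP => x Xx /=; rewrite !mevalM.
have := hrepr_eq p Xx; have := hrepr_eq q Xx.
set a := (hnum p).@[_]; set b := (hden p).@[_].
set c := (hnum q).@[_]; set d := (hden q).@[_].
set a' := (hnum _).@[_]; set b' := (hden _).@[_].
set c' := (hnum _).@[_]; set d' := (hden _).@[_] => h1 h2.
by ring: h1 h2.
Qed.

Lemma ratfun_eq0 p : \pi_ratfun p = rzero <-> ~ nonvanishing (hnum p).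
Proof.
split=> [/ratfun_eqP h [x Xx]|h]; last first.
  apply/ratfun_eqP => x Xx /=; rewrite mevalC meval1 mul0r mulr1.
  by apply/eqP; apply: contrapT => /negP px; apply: h; exists x.
by have := h x Xx; rewrite /= mevalC meval1 mul0r mulr1 => ->; rewrite eqxx.
Qed.

Lemma rzeroE : rzero = \pi_ratfun (hconst 0). Proof. by []. Qed.
Lemma roneE : rone = \pi_ratfun (hconst 1). Proof. by []. Qed.

Definition pi_rE := (radd_pi, ropp_pi, rmul_pi, rzeroE, roneE).
Definition mevalE' := (mevalD, mevalN, mevalM, mevalC, meval1).

Lemma raddA : associative radd.
Proof.
elim/quotW=> p; elim/quotW=> q; elim/quotW=> r; rewrite !pi_rE.
by apply/ratfun_eqP => x _ /=; rewrite !mevalE'; ring.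
Qed.

Lemma raddC : commutative radd.
Proof.
elim/quotW=> p; elim/quotW=> q; rewrite !pi_rE.
by apply/ratfun_eqP => x _ /=; rewrite !mevalE'; ring.
Qed.

Lemma radd0 : left_id rzero radd.
Proof.
elim/quotW=> p; rewrite !pi_rE.
by apply/ratfun_eqP => x _ /=; rewrite !mevalE'; ring.
Qed.

Lemma raddN : left_inverse rzero ropp radd.
Proof.
elim/quotW=> p; rewrite !pi_rE.
by apply/ratfun_eqP => x _ /=; rewrite !mevalE'; ring.
Qed.

HB.instance Definition _ := GRing.isZmodule.Build ratfun raddA raddC radd0 raddN.

Lemma rmulA : associative rmul.
Proof.
elim/quotW=> p; elim/quotW=> q; elim/quotW=> r; rewrite !pi_rE.
by apply/ratfun_eqP => x _ /=; rewrite !mevalE'; ring.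
Qed.

Lemma rmulC : commutative rmul.
Proof.
elim/quotW=> p; elim/quotW=> q; rewrite !pi_rE.
by apply/ratfun_eqP => x _ /=; rewrite !mevalE'; ring.
Qed.

Lemma rmul1 : left_id rone rmul.
Proof.
elim/quotW=> p; rewrite !pi_rE.
by apply/ratfun_eqP => x _ /=; rewrite !mevalE'; ring.
Qed.

Lemma rmulD : left_distributive rmul radd.
Proof.
elim/quotW=> p; elim/quotW=> q; elim/quotW=> r; rewrite !pi_rE.
by apply/ratfun_eqP => x _ /=; rewrite !mevalE'; ring.
Qed.

Lemma rone_neq0 : rone != rzero.
Proof.
apply/eqP => /ratfun_eq0; apply.
have [[x Xx] _] := points_irreducible X; exists x => //=.
by rewrite mevalC oner_neq0.
Qed.

HB.instance Definition _ :=
  GRing.Zmodule_isComNzRing.Build ratfun rmulA rmulC rmul1 rmulD rone_neq0.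

Lemma rmulV : forall f, f != rzero -> rmul (rinv f) f = rone.
Proof.
move=> f /eqP; rewrite -[f in f <> _]reprK => /ratfun_eq0/contrapT np.
unlock rinv; rewrite -[f in rmul _ f]reprK !pi_rE; apply/ratfun_eqP => x _.
by rewrite /= /hinv; case: pselect => //= ?; rewrite !mevalE'; ring.
Qed.

Lemma rinv0 : rinv rzero = rzero.
Proof.
unlock rinv; rewrite /hinv; case: pselect => //= np.
by case: (ratfun_eq0 (repr rzero)); rewrite reprK => /(_ erefl).
Qed.

HB.instance Definition _ := GRing.ComNzRing_isField.Build ratfun rmulV rinv0.

Definition ratconst (c : k) : ratfun := \pi_ratfun (hconst c).

Lemma ratconst_is_zmod_morphism : zmod_morphism ratconst.
Proof.
move=> c d; rewrite -[RHS]/(radd _ (ropp _)) /ratconst !pi_rE.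
by apply/ratfun_eqP => x _ /=; rewrite !mevalE'; ring.
Qed.

HB.instance Definition _ :=
  GRing.isZmodMorphism.Build k ratfun ratconst ratconst_is_zmod_morphism.

Lemma ratconst_is_monoid_morphism : monoid_morphism ratconst.
Proof.
split=> // c d; rewrite -[RHS]/(rmul _ _) /ratconst !pi_rE.
by apply/ratfun_eqP => x _ /=; rewrite !mevalE'; ring.
Qed.

HB.instance Definition _ :=
  GRing.isMonoidMorphism.Build k ratfun ratconst ratconst_is_monoid_morphism.

End FunctionField.

Section Pullback.
Variables (X Y : qpvar) (f : dratmap X Y).

Lemma vanish_pull d (p : {mpoly k[ncoord Y]}) : p \is d.-homog ->
  (forall y, points Y y -> p.@[y 0] = 0) ->
  forall x, points X x -> (p \mPo rforms f).@[x 0] = 0.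
Proof.
move=> hp pY x Xx; apply: contrapT => /eqP px.
have [[e hF] [W [cW nW FW]]] := dratmap_ratmap f.
have hpF : p \mPo rforms f \is (e * d).-homog by apply: dhomog_comp.
have np : nonvanishing (p \mPo rforms f) by exists x.
have [z [Xz /eqP pz Wz]] := nonvanishingW hpF cW np nW.
by apply: pz; rewrite meval_rmap pY //; apply: FW.
Qed.

Definition hpull (q : hfrac Y) : hfrac X.
Proof.
refine (@HFrac X (hnum q \mPo rforms f) (hden q \mPo rforms f) _ _).
  have [d [hn hd]] := hfrac_homog q; have [[e hF] _] := dratmap_ratmap f.
  by exists (e * d)%N; split; apply: dhomog_comp.
have [d [hn hd]] := hfrac_homog q.
exact: nonvanishing_pull hd (hden_nv q).
Defined.

(* g |-> g o f; independent of the representative P/Q of g by pullback_pi *)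
Definition pullback (g : ratfun Y) : ratfun X := \pi_(ratfun X) (hpull (repr g)).

Lemma pullback_pi q : pullback (\pi_(ratfun Y) q) = \pi_(ratfun X) (hpull q).
Proof.
apply/ratfun_eqP => x Xx /=; set r := repr _.
have [d [hn hd]] := hfrac_homog q; have [e [rn rd]] := hfrac_homog r.
have h : hnum r * hden q - hnum q * hden r \is (e + d).-homog.
  by apply: rpredB; [|rewrite addnC]; apply: dhomogM.
have /(vanish_pull h)/(_ _ Xx) : forall y, points Y y ->
    (hnum r * hden q - hnum q * hden r).@[y 0] = 0.
  by move=> y Yy; rewrite mevalB !mevalM; apply/eqP; rewrite subr_eq0 hrepr_eq.
rewrite meval_rmap mevalB !mevalM => /eqP; rewrite subr_eq0 => /eqP.
by rewrite !meval_rmap.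
Qed.

Lemma pullback_is_zmod_morphism : zmod_morphism pullback.
Proof.
elim/quotW=> p; elim/quotW=> q.
rewrite -[_ - _ in LHS]/(radd _ (ropp _)) -[RHS]/(radd _ (ropp _)) !pullback_pi.
rewrite !pi_rE pullback_pi; apply/ratfun_eqP => x _ /=.
by rewrite !meval_rmap !mevalE' !meval_rmap.
Qed.

HB.instance Definition _ :=
  GRing.isZmodMorphism.Build (ratfun Y) (ratfun X) pullback pullback_is_zmod_morphism.

Lemma pullback_is_monoid_morphism : monoid_morphism pullback.
Proof.
split.
  rewrite -[1 in LHS]/(rone Y) roneE pullback_pi; apply/ratfun_eqP => x _ /=.
  by rewrite !meval_rmap !mevalE'.
elim/quotW=> p; elim/quotW=> q.
rewrite -[_ * _ in LHS]/(rmul _ _) -[RHS]/(rmul _ _) !pullback_pi.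
rewrite !pi_rE pullback_pi; apply/ratfun_eqP => x _ /=.
by rewrite !meval_rmap !mevalE' !meval_rmap.
Qed.

HB.instance Definition _ :=
  GRing.isMonoidMorphism.Build (ratfun Y) (ratfun X) pullback
    pullback_is_monoid_morphism.

Lemma pullback_const c : pullback (ratconst Y c) = ratconst X c.
Proof.
rewrite pullback_pi; apply/ratfun_eqP => x _ /=.
by rewrite !meval_rmap !mevalC.
Qed.

End Pullback.

Record ratdyn := RatDyn { dvar : qpvar; dmap : dratmap dvar dvar }.

Definition prod_dyn (S T : ratdyn) : ratdyn :=
  RatDyn (prod_map (dmap S) (dmap T)).

(* the n-th cartesian power for n >= 1 (S itself for n = 0) *)
Definition power_dyn (S : ratdyn) (n : nat) : ratdyn := iter n.-1 (prod_dyn S) S.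

Definition invariants (S : ratdyn) : set (ratfun (dvar S)) :=
  [set f | pullback (dmap S) f = f].

Definition nonconstant (X : qpvar) (f : ratfun X) : Prop :=
  ~ exists c : k, f = ratconst X c.

Arguments invariants S : clear implicits.

Definition adim (S : ratdyn) : nat := trdeg (ratconst (dvar S)) (invariants S).

End ProjectiveSpace.

Arguments points {k} _.
Arguments invariants {k} _.

(* Main.v *)
Require Import Defs.
From mathcomp Require Import all_boot all_order all_algebra.
From mathcomp Require Import boolp classical_sets.
From mathcomp Require Import mpoly.

(* Write K = k(X), L = k(Y), M = k(X x Y), Theta = (phi x id)^*, Psi = (phi x psi)^*
   and N = Fix(M, Psi).  The theorem amounts to: if X x X has only constant
   invariants, then N is contained in L.

   Artin's independence argument shows that a Theta-stable subfield E of M is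
   linearly disjoint from Fix(M, Theta) over Fix(E, Theta).  Hence, when a system Z
   has only constant invariants, Fix(k(Z x Y), (zeta x id)^* ) = k(Y).

   Since Theta and Psi commute, E = K N is Theta-stable.  Let h be an element of
   Fix(E, Theta), h = sum a_i u_i / sum a_i v_i with a_i in K independent over k and
   u_i, v_i in N.  Then H(x, x', y) = sum a_i(x) u_i(x', y) / sum a_i(x) v_i(x', y)
   is invariant under phi x phi x id, because K and N are linearly disjoint over k.
   So H is a function l of y alone, whence u_i = l v_i for all i, and h = l = u_i / v_i
   lies in N.  Thus Fix(E, Theta) is contained in N.

   Finally write f in N as sum l_i u_i / sum l_i v_i with l_i in L independent over
   Fix(E, Theta) and u_i, v_i in E where Theta and Psi agree.  The l_i are independent
   over E, which contains f, so f = u_i / v_i for some i, and Theta f = Psi f = f.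
   Therefore f lies in Fix(M, Theta) = L. *)

Set Implicit Arguments.
Unset Strict Implicit.
Unset Printing Implicit Defensive.

Import GRing.Theory.
Local Open Scope ring_scope.
Local Open Scope classical_set_scope.

(** * Linear disjointness from fixed fields *)

Section LinearDisjointness.
Variable M : fieldType.
Implicit Types E F : set M.

(** Subfields are sets in one ambient field, so that they can be intersected and multiplied
    together. Closure under inverse needs no case at 0, since [0^-1 = 0]. *)
Record subfield E : Prop := Subfield {
  subfield1 : E 1;
  subfieldB : forall x y, E x -> E y -> E (x - y);
  subfieldM : forall x y, E x -> E y -> E (x * y);
  subfieldV : forall x, E x -> E x^-1 }.

Section SubfieldTheory.
Variables (E : set M) (sE : subfield E).

Lemma subfield0 : E 0.
Proof. by rewrite -(subrr 1); apply: subfieldB => //; apply: subfield1. Qed.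

Lemma subfieldN x : E x -> E (- x).
Proof. by move=> Ex; rewrite -sub0r; apply: subfieldB => //; apply: subfield0. Qed.

Lemma subfieldD x y : E x -> E y -> E (x + y).
Proof. by move=> Ex Ey; rewrite -[y]opprK; apply: subfieldB => //; apply: subfieldN. Qed.

Lemma subfield_div x y : E x -> E y -> E (x / y).
Proof. by move=> Ex Ey; apply: subfieldM => //; apply: subfieldV. Qed.

Lemma subfield_sum (I : finType) (P : pred I) (x : I -> M) :
  (forall i, P i -> E (x i)) -> E (\sum_(i | P i) x i).
Proof.
move=> Ex; elim/big_ind: _ => //; first exact: subfield0.
by move=> ? ?; apply: subfieldD.
Qed.

End SubfieldTheory.

Lemma subfieldI E F : subfield E -> subfield F -> subfield (E `&` F).
Proof.
move=> sE sF; split; first by split; apply: subfield1.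
- by move=> x y [? ?] [? ?]; split; apply: subfieldB.
- by move=> x y [? ?] [? ?]; split; apply: subfieldM.
- by move=> x [? ?]; split; apply: subfieldV.
Qed.

Definition fixed (s : M -> M) : set M := [set x | s x = x].

Lemma subfield_equalizer (s t : {rmorphism M -> M}) : subfield [set x | s x = t x].
Proof.
split=> /=; first by rewrite !rmorph1.
- by move=> x y ex ey; rewrite !rmorphB ex ey.
- by move=> x y ex ey; rewrite !rmorphM ex ey.
- by move=> x ex; rewrite !fmorphV ex.
Qed.

Lemma subfield_fixed (s : {rmorphism M -> M}) : subfield (fixed s).
Proof. exact: (subfield_equalizer s idfun). Qed.

Lemma subfield_range (K : fieldType) (g : {rmorphism K -> M}) : subfield (range g).
Proof.
split; first by exists 1 => //; rewrite rmorph1.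
- by move=> _ _ [x _ <-] [y _ <-]; exists (x - y) => //; rewrite rmorphB.
- by move=> _ _ [x _ <-] [y _ <-]; exists (x * y) => //; rewrite rmorphM.
- by move=> _ [x _ <-]; exists x^-1 => //; rewrite fmorphV.
Qed.

Definition independent E (I : finType) (a : I -> M) : Prop :=
  forall c : I -> M, (forall i, E (c i)) -> \sum_i c i * a i = 0 ->
  forall i, c i = 0.

(** Among the finite families in [F] whose [E]-span contains every [a i] ([a] is one of them), a
    family of least cardinality is independent. *)
Lemma exists_basis E F (I : finType) (a : I -> M) : subfield E ->
  (forall i, F (a i)) ->
  exists (J : finType) (b : J -> M) (c : I -> J -> M),
    [/\ independent E b, forall j, F (b j), forall i j, E (c i j)
      & forall i, a i = \sum_j c i j * b j].
Proof.
move=> sE Fa.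
pose P n := `[< exists (J : finType) (b : J -> M) (c : I -> J -> M),
  [/\ #|J| = n, forall j, F (b j), forall i j, E (c i j)
      & forall i, a i = \sum_j c i j * b j] >].
have exP : exists n, P n.
  exists #|I|; apply/asboolP; exists I, a, (fun i j => (i == j)%:R); split=> //.
    by move=> i j; case: eqP => _; [apply: subfield1|apply: subfield0].
  move=> i; rewrite (bigD1 i) //= eqxx mul1r big1 ?addr0 // => j /negPf.
  by rewrite eq_sym => ->; rewrite mul0r.
case: (ex_minnP exP) => n /asboolP[J [b [c [cJ Fb Ec ac]]]] minn.
exists J, b, c; split=> // d Ed d0 j0; apply: contrapT => /eqP dj0.
suff /asboolP/minn : exists (J : finType) (b : J -> M) (c : I -> J -> M),
  [/\ #|J| = n.-1, forall j, F (b j), forall i j, E (c i j)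
      & forall i, a i = \sum_j c i j * b j].
  have : (0 < n)%N by rewrite -cJ; apply/card_gt0P; exists j0.
  by case: n {minn cJ} => // n _; rewrite ltnn.
(* As [d j0] is nonzero, the relation [d] expresses [b j0] through the other [b j]; substituting
   gives these coefficients. *)
exists {j in predC1 j0}, (fun j => b (val j)),
  (fun i j => c i (val j) - c i j0 * d (val j) / d j0); split.
- by rewrite card_sig -cJ -(cardC1 j0); apply: eq_card.
- by [].
- move=> i j; apply: subfieldB => //; apply: subfield_div => //.
  exact: subfieldM.
move=> i; rewrite ac.
rewrite -(big_sub (predC1 j0) (fun j => (c i j - c i j0 * d j / d j0) * b j)).
have {d0} : c i j0 / d j0 * \sum_j d j * b j = 0 by rewrite d0 mulr0.
rewrite !(bigD1 j0 (P := predT)) //= mulrDr mulrA divfK // => e.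
rewrite -[LHS]subr0 -[X in _ - X]e opprD addrACA subrr add0r mulr_sumr -sumrB.
by apply: eq_bigr => j _; rewrite mulrBl !mulrA (mulrAC (c i j0)).
Qed.

Lemma sum_mul_neq0 (I : finType) (a v : I -> M) :
  \sum_i a i * v i != 0 -> exists i, v i != 0.
Proof.
move=> av0; apply: contrapT => h; move/eqP: av0; apply; rewrite big1 // => i _.
have [->|vi] := eqVneq (v i) 0; first by rewrite mulr0.
by case: h; exists i.
Qed.

(* Artin's argument: a relation of minimal support, normalised to have a
   coefficient 1, is fixed by s. *)
Lemma fixed_independent (s : {rmorphism M -> M}) E (I : finType) (e l : I -> M) :
  subfield E -> (forall x, E x -> E (s x)) ->
  (forall i, E (e i)) -> (forall i, fixed s (l i)) ->
  independent (E `&` fixed s) l -> \sum_i e i * l i = 0 -> forall i, e i = 0.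
Proof.
move=> sE Es Ee fl il.
have [n] := ubnP #|[pred i | e i != 0]|; elim: n e Ee => // n IH e Ee cn e0.
move=> i0; apply: contrapT => /eqP ei0.
pose e' i := e i / e i0.
have Ee' i : E (e' i) by apply: subfield_div.
have e'0 : \sum_i e' i * l i = 0.
  rewrite -[RHS](mul0r (e i0)^-1) -[X in _ = X * _]e0 mulr_suml.
  by apply: eq_bigr => i _; rewrite mulrAC.
have se'0 : \sum_i s (e' i) * l i = 0.
  rewrite -[RHS](rmorph0 s) -[X in _ = s X]e'0 rmorph_sum.
  by apply: eq_bigr => i _; rewrite rmorphM (fl i).
(* The differences form a relation of strictly smaller support, because [e' i0 = 1] is fixed. *)
have fe' i : s (e' i) - e' i = 0.
  apply: (IH (fun i => s (e' i) - e' i)) => {i}[i||].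
  - by apply: subfieldB => //; apply: Es.
  - rewrite -ltnS (leq_trans _ cn) // ltnS; apply: proper_card.
    apply/properP; split; last first.
      by exists i0; rewrite inE // /e' divff // rmorph1 subrr eqxx.
    apply/fintype.subsetP => i; rewrite !inE; apply: contraNneq => ei.
    by rewrite /e' ei mul0r rmorph0 subrr.
  - under eq_bigr do rewrite mulrBl.
    by rewrite sumrB e'0 se'0 subr0.
have : e' i0 = 0.
  by apply: il e'0 _ => i; split=> //; apply/eqP; rewrite -subr_eq0; apply/eqP.
by apply/eqP; rewrite /e' divff // oner_neq0.
Qed.

(** Mirror image of [fixed_independent]: write the [l i] over a basis of fixed elements. In the
    relation each basis element gets a coefficient in [E], which vanishes, and the independence of
    [a] finishes. *)
Lemma independent_over_fixed (s : {rmorphism M -> M}) E (I : finType) (a l : I -> M) :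
  subfield E -> (forall x, E x -> E (s x)) ->
  (forall i, E (a i)) -> (forall i, fixed s (l i)) ->
  independent (E `&` fixed s) a -> \sum_i a i * l i = 0 -> forall i, l i = 0.
Proof.
move=> sE Es Ea fl ia al0.
have sEs := subfieldI sE (subfield_fixed s).
have [J [b [c [ib fb Ec lb]]]] := exists_basis (F := fixed s) sEs fl.
have ac0 j : \sum_i c i j * a i = 0.
  apply: (fixed_independent (e := fun j => \sum_i c i j * a i) sE Es _ fb ib).
    by move=> j'; apply: subfield_sum => // i _; apply: subfieldM => //; case: (Ec i j').
  rewrite -[RHS]al0; under eq_bigr do rewrite mulr_suml.
  rewrite exchange_big; apply: eq_bigr => i _.
  by rewrite lb mulr_sumr; apply: eq_bigr => j' _; rewrite mulrA [a i * _]mulrC.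
move=> i; rewrite lb big1 // => j _.
by rewrite (ia (fun i => c i j)) ?mul0r.
Qed.

(** For subfields this is the ring generated by [E] and [F], and [compositum] is its field of
    fractions. *)
Definition sumprod E F : set M := [set x |
  exists (I : finType) (a l : I -> M),
    [/\ forall i, E (a i), forall i, F (l i) & x = \sum_i a i * l i]].

Definition compositum E F : set M := [set x |
  exists u v, [/\ sumprod E F u, sumprod E F v, v != 0 & x * v = u]].

Lemma sumprodC E F x : sumprod E F x -> sumprod F E x.
Proof.
move=> [I [a [l [? ? ->]]]]; exists I, l, a; split=> //.
by apply: eq_bigr => i _; rewrite mulrC.
Qed.

Lemma compositumC E F x : compositum E F x -> compositum F E x.
Proof. by move=> [u [v [? ? ? ?]]]; exists u, v; split=> //; apply: sumprodC. Qed.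

Lemma sumprodW E E' F F' x : E `<=` E' -> F `<=` F' ->
  sumprod E F x -> sumprod E' F' x.
Proof.
by move=> hE hF [I [a [l [? ? ->]]]]; exists I, a, l; split=> // i; [apply: hE|apply: hF].
Qed.

Lemma compositumW E E' F F' x : E `<=` E' -> F `<=` F' ->
  compositum E F x -> compositum E' F' x.
Proof.
by move=> hE hF [u [v [? ? ? ?]]]; exists u, v; split=> //; apply: sumprodW; eassumption.
Qed.

Lemma sumprod1 E F x y : E x -> F y -> sumprod E F (x * y).
Proof.
move=> Ex Fy; exists unit, (fun=> x), (fun=> y); split=> //.
by rewrite (bigD1 tt) //= big1 ?addr0 // => -[].
Qed.

Lemma sumprodD E F x y : sumprod E F x -> sumprod E F y -> sumprod E F (x + y).
Proof.
move=> [I [a [l [Ea Fl ->]]]] [J [b [m [Eb Fm ->]]]].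
exists (I + J)%type, (fun t => match t with inl i => a i | inr j => b j end),
  (fun t => match t with inl i => l i | inr j => m j end).
by split; [case|case|rewrite big_sumType].
Qed.

Lemma sumprodM E F x y : subfield E -> subfield F ->
  sumprod E F x -> sumprod E F y -> sumprod E F (x * y).
Proof.
move=> sE sF [I [a [l [Ea Fl ->]]]] [J [b [m [Eb Fm ->]]]].
exists (I * J)%type, (fun t => a t.1 * b t.2), (fun t => l t.1 * m t.2).
split; try by move=> [i j]; apply: subfieldM.
rewrite big_distrlr /= pair_big /=.
by apply: eq_bigr => i _; rewrite mulrACA.
Qed.

Lemma sumprodN E F x : subfield E -> sumprod E F x -> sumprod E F (- x).
Proof.
move=> sE [I [a [l [Ea Fl ->]]]]; exists I, (fun i => - a i), l; split=> //.
  by move=> i; apply: subfieldN.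
by rewrite -sumrN; apply: eq_bigr => i _; rewrite mulNr.
Qed.

Lemma compositum_subfield E F : subfield E -> subfield F -> subfield (compositum E F).
Proof.
move=> sE sF.
have R1 : sumprod E F 1 by rewrite -[1]mulr1; apply: sumprod1; apply: subfield1.
split.
- by exists 1, 1; split=> //; rewrite ?oner_neq0 ?mulr1.
- move=> x y [u [v [Ru Rv v0 xv]]] [u' [v' [Ru' Rv' v0' xv']]].
  exists (u * v' - u' * v), (v * v'); split; rewrite ?mulf_neq0 //.
  + by apply: sumprodD; [|apply: sumprodN => //]; apply: sumprodM.
  + exact: sumprodM.
  + by rewrite -xv -xv' mulrBl !mulrA; congr (_ - _); rewrite -!mulrA; congr (_ * _); rewrite mulrC.
- move=> x y [u [v [Ru Rv v0 xv]]] [u' [v' [Ru' Rv' v0' xv']]].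
  exists (u * u'), (v * v'); split; rewrite ?mulf_neq0 //; try exact: sumprodM.
  by rewrite -xv -xv' mulrACA.
- move=> x [u [v [Ru Rv v0 xv]]].
  have [->|x0] := eqVneq x 0.
    exists 0, 1; split; rewrite ?oner_neq0 ?invr0 ?mul0r //.
    by rewrite -(subrr 1); apply: sumprodD => //; apply: sumprodN.
  exists v, u; split=> //; first by rewrite -xv mulf_neq0.
  by rewrite -xv mulKf.
Qed.

Lemma compositum_sub E F : subfield E -> subfield F -> E `<=` compositum E F.
Proof.
move=> sE sF x Ex; exists x, 1; split; rewrite ?oner_neq0 ?mulr1 //.
  by rewrite -[x]mulr1; apply: sumprod1 => //; apply: subfield1.
by rewrite -[1]mulr1; apply: sumprod1; apply: subfield1.
Qed.

Lemma compositum_stable (s : {rmorphism M -> M}) E F :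
  (forall x, E x -> E (s x)) -> (forall x, F x -> F (s x)) ->
  forall x, compositum E F x -> compositum E F (s x).
Proof.
move=> sE sF x.
have sR y : sumprod E F y -> sumprod E F (s y).
  move=> [I [a [l [Ea Fl ->]]]]; exists I, (s \o a), (s \o l); split=> /= [i|i|].
  - exact: sE.
  - exact: sF.
  - by rewrite rmorph_sum; apply: eq_bigr => i _; rewrite rmorphM.
move=> [u [v [Ru Rv v0 xv]]]; exists (s u), (s v); split.
- exact: sR.
- exact: sR.
- by rewrite fmorph_eq0.
- by rewrite -xv rmorphM.
Qed.

(** Numerator and denominator are rewritten over one common family independent over [E0]; the new
    coefficients lie in [E0], hence in [F], and are absorbed into [u] and [v]. *)
Lemma compositum_normal_form E0 E F x :
  subfield E0 -> subfield F -> E0 `<=` F -> compositum E F x ->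
  exists (I : finType) (a u v : I -> M),
    [/\ independent E0 a, forall i, E (a i),
        forall i, F (u i) /\ F (v i)
      & x * \sum_i a i * v i = \sum_i a i * u i /\ \sum_i a i * v i != 0].
Proof.
move=> sE0 sF E0F [_ [_ [[I [a [u [Ea Fu ->]]]] [J [b [v [Eb Fv ->]]]] v0 xv]]].
pose ab t := match t with inl i => a i | inr j => b j end.
have Eab : forall t, E (ab t) by case.
have [H [h [c [ih Eh Ec hE]]]] := exists_basis (F := E) sE0 Eab.
have sumE (K : finType) (g : K -> I + J) (w : K -> M) :
    \sum_t h t * \sum_i c (g i) t * w i = \sum_i ab (g i) * w i.
  under eq_bigr do rewrite mulr_sumr.
  rewrite exchange_big; apply: eq_bigr => i _.
  by rewrite hE mulr_suml; apply: eq_bigr => t _; rewrite mulrA [h t * _]mulrC.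
exists H, h, (fun t => \sum_i c (inl i) t * u i), (fun t => \sum_j c (inr j) t * v j).
split=> //; last by rewrite (sumE _ inl) (sumE _ inr).
by move=> t; split; apply: subfield_sum => // i _; apply: subfieldM => //; apply: E0F.
Qed.

(** Since [x], [u_i] and [v_i] are fixed, [sum a_i (u_i - x v_i) = 0] has fixed coefficients, so
    [u_i = x v_i] for all [i], and [x] is a quotient [u_i / v_i]. *)
Lemma fixed_compositum (s : {rmorphism M -> M}) E F x :
  subfield E -> (forall y, E y -> E (s y)) -> subfield F ->
  F `<=` fixed s -> E `&` fixed s `<=` F ->
  compositum E F x -> fixed s x -> F x.
Proof.
move=> sE Es sF Ffix EF cx fx.
have sfix := subfield_fixed s.
have [I [a [u [v [ia Ea uv [xv v0]]]]]] :=
  compositum_normal_form (subfieldI sE sfix) sF EF cx.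
have e i : u i - x * v i = 0.
  apply: (independent_over_fixed (l := fun i => u i - x * v i) sE Es Ea _ ia) => {i}[i|].
    have [Fu Fv] := uv i.
    apply: (subfieldB sfix); first exact: Ffix.
    by apply: (subfieldM sfix); last exact: Ffix.
  apply/eqP; under eq_bigr do rewrite mulrBr mulrCA.
  by rewrite sumrB -mulr_sumr xv subrr.
have [i vi0] := sum_mul_neq0 v0.
have /eqP := e i; rewrite subr_eq0 => /eqP eu.
rewrite -[x](mulfK vi0) -eu; apply: subfield_div => //.
  by case: (uv i).
by case: (uv i).
Qed.

End LinearDisjointness.

(** * Descent of invariants in an abstract field *)

Section Descent.
(** In the application [M = k(X x Y)], [A = k(X x X x Y)], [K = k(X)], [L = k(Y)]; [s], [t], [r] are
    the pullbacks by [phi x id], [phi x psi], [phi x phi x id], and [p1], [p2] send [f] to [f(x, y)]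
    and [f(x', y)]. *)
Variables (M A : fieldType) (s t : {rmorphism M -> M}) (r : {rmorphism A -> A}).
Variables (p1 p2 : {rmorphism M -> A}) (K L : set M).
Hypothesis st : forall x, s (t x) = t (s x).
Hypotheses (sK : subfield K) (sL : subfield L).
Hypotheses (Ks : forall x, K x -> K (s x)) (Kst : forall x, K x -> s x = t x).
Hypotheses (Ls : L `<=` fixed s) (Kfixed : K `&` fixed s `<=` L).
Hypothesis KL : forall x, compositum K L x.
Hypotheses (rp1 : forall x, r (p1 x) = p1 (s x)) (rp2 : forall x, r (p2 x) = p2 (s x)).
Hypothesis p12 : forall x, K x -> fixed s x -> p1 x = p2 x.
Hypothesis p1_independent : forall (I : finType) (a m : I -> M), (forall i, K (a i)) ->
  independent (K `&` fixed s) a -> \sum_i p1 (a i) * p2 (m i) = 0 -> forall i, m i = 0.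
Hypothesis fixed_r : forall y, r y = y -> exists2 l, L l & y = p2 l.

Let N := fixed t.
Let sN : subfield N := subfield_fixed t.

Let KN : K `&` fixed s = K `&` fixed t.
Proof.
by apply/seteqP; split=> x [Kx fx]; split=> //; rewrite /fixed /= -?Kst // Kst.
Qed.

Let Kt x : K x -> K (t x). Proof. by move=> Kx; rewrite -Kst //; apply: Ks. Qed.

Let Ns x : N x -> N (s x).
Proof. by move=> Nx; rewrite /N /fixed /= -st [t x]Nx. Qed.

(* K and N are linearly disjoint over the elements of K fixed by s, and p1 and p2
   agree on these, so that K-linear relations between elements of N survive when
   K and N are embedded into A by different morphisms. *)
Let transport (I : finType) (b n : I -> M) : (forall i, K (b i)) -> (forall i, N (n i)) ->
  \sum_i b i * n i = 0 -> \sum_i p1 (b i) * p2 (n i) = 0.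
Proof.
move=> Kb Nn bn0.
have sC := subfieldI sK (subfield_fixed s).
have [J [g [c [ig Kg Cc bE]]]] := exists_basis (F := K) sC Kb.
have n0 j : \sum_i c i j * n i = 0.
  have ig' : independent (K `&` fixed t) g by rewrite -KN.
  apply: (independent_over_fixed (l := fun j => \sum_i c i j * n i) sK Kt Kg _ ig').
    move=> j'; apply: subfield_sum => // i _; apply: subfieldM => //; last exact: Nn.
    by have [Kc fc] := Cc i j'; rewrite /fixed /= -Kst.
  rewrite -[RHS]bn0; under eq_bigr do rewrite mulr_sumr.
  rewrite exchange_big; apply: eq_bigr => i _.
  by rewrite bE mulr_suml; apply: eq_bigr => j' _; rewrite mulrA [g j' * _]mulrC.
transitivity (\sum_j p1 (g j) * p2 (\sum_i c i j * n i)); last first.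
  by rewrite big1 // => j _; rewrite n0 rmorph0 mulr0.
under [RHS]eq_bigr do rewrite rmorph_sum mulr_sumr.
rewrite exchange_big; apply: eq_bigr => i _.
rewrite bE rmorph_sum mulr_suml; apply: eq_bigr => j _ /=.
by rewrite !rmorphM (p12 (proj1 (Cc i j)) (proj2 (Cc i j))) mulrCA mulrA.
Qed.

(** [U / V] is the function [H(x, x', y)]: the [a_i] are read on the first copy of [X], the [u_i]
    and [v_i] on the second. *)
Let fixed_sub x : compositum K N x -> fixed s x -> N x.
Proof.
move=> cx fx.
have sC := subfieldI sK (subfield_fixed s).
have CN : K `&` fixed s `<=` N by rewrite KN => ? [].
have [I [a [u [v [ia Ka Nuv [xv v0]]]]]] := compositum_normal_form sC sN CN cx.
pose U := \sum_i p1 (a i) * p2 (u i); pose V := \sum_i p1 (a i) * p2 (v i).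
have V0 : V != 0.
  apply/eqP => /(p1_independent Ka ia) v0'; move/eqP: v0; apply.
  by rewrite big1 // => i _; rewrite v0' mulr0.
(* This says that [U / V] is fixed by [r]. Cross-multiplying [s x = x] gives a [K]-linear relation
   between elements of [N], indexed by pairs, which [transport] carries to [A]. *)
have cross : r U * V = U * r V.
  have /transport h : \sum_(ij : I * I) (s (a ij.1) * a ij.2) *
     (s (u ij.1) * v ij.2 - u ij.2 * s (v ij.1)) = 0.
    under eq_bigr do rewrite mulrBr.
    rewrite sumrB; apply/eqP; rewrite subr_eq0; apply/eqP.
    transitivity (s (\sum_i a i * u i) * \sum_i a i * v i).
      rewrite rmorph_sum big_distrlr /= pair_big /=; apply: eq_bigr => i _.
      by rewrite rmorphM mulrACA.
    rewrite -xv rmorphM [s x]fx mulrC mulrCA mulrA xv mulrC.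
    rewrite rmorph_sum big_distrlr /= pair_big /=; apply: eq_bigr => i _.
    by rewrite rmorphM mulrACA [s (v _) * _]mulrC.
  apply/eqP; rewrite -subr_eq0 -[X in _ == X]h => [|i|i]; last 2 first.
  - by apply: subfieldM => //; apply: Ks.
  - have [[Nu1 Nv1] [Nu2 Nv2]] := (Nuv i.1, Nuv i.2).
    by apply: (subfieldB sN); apply: (subfieldM sN) => //; apply: Ns.
  apply/eqP; rewrite /U /V !rmorph_sum /= [X in _ - X]mulrC !big_distrlr /= !pair_big /= -sumrB.
  apply: eq_bigr => i _; rewrite !rmorphM !rmorphB !rmorphM !rp1 !rp2 mulrBr.
  by rewrite mulrACA; congr (_ - _); rewrite mulrACA [p2 (u _) * _]mulrC.
have [l Ll UVl] : exists2 l, L l & U / V = p2 l.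
  apply: fixed_r; rewrite fmorph_div.
  by apply/eqP; rewrite eqr_div ?fmorph_eq0 //; apply/eqP.
(* [U = p2 l * V] is a relation with the independent [a_i] on one side and the [u_i - l v_i] on the
   other. *)
have e i : u i - l * v i = 0.
  apply: (p1_independent (m := fun i => u i - l * v i) Ka ia).
  under eq_bigr do rewrite rmorphB rmorphM mulrBr mulrCA.
  by rewrite sumrB -mulr_sumr -UVl -/U -/V divfK // subrr.
have [i vi0] := sum_mul_neq0 v0.
have -> : x = l.
  apply: (mulIf v0); rewrite xv mulr_sumr; apply: eq_bigr => j _.
  by have /eqP := e j; rewrite subr_eq0 => /eqP ->; rewrite mulrCA.
have /eqP := e i; rewrite subr_eq0 => /eqP eu.
by rewrite -[l](mulfK vi0) -eu; have [Nu Nv] := Nuv i; apply: subfield_div.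
Qed.

Lemma fixed_descent : N `<=` L.
Proof.
move=> f Nf.
have fixL x : fixed s x -> L x.
  exact: (fixed_compositum sK Ks sL Ls Kfixed (KL x)).
apply: fixL.
pose E := compositum K N.
have sE : subfield E by apply: compositum_subfield.
have KE : K `<=` E by apply: compositum_sub.
have NE : N `<=` E by move=> x Nx; apply: compositumC; apply: compositum_sub Nx.
(* [F] contains [K], where [s] and [t] agree by hypothesis, and the [s]-fixed part of [E], where
   both are the identity by [fixed_sub]. *)
pose F := E `&` [set x | s x = t x].
have sF : subfield F by apply: subfieldI => //; apply: subfield_equalizer.
pose E0 := E `&` fixed s.
have E0F : E0 `<=` F.
  move=> x [Ex fx]; split=> //=; have Nx := fixed_sub Ex fx.
  by rewrite [s x]fx [t x]Nx.
have cf : compositum L F f.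
  apply: compositumC; apply: compositumW (KL f) => // x Kx.
  by split; [apply: KE|apply: Kst].
have [I [l [u [v [il Ll Fuv [fv v0]]]]]] :=
  compositum_normal_form (subfieldI sE (subfield_fixed s)) sF E0F cf.
have Es x : E x -> E (s x) by apply: compositum_stable.
(* [f] lies in [N], hence in [E], so this relation between the [s]-fixed [l i] has coefficients in
   [E]. *)
have e i : u i - f * v i = 0.
  apply: (fixed_independent (e := fun i => u i - f * v i) sE Es _ _ il) => {i}[i|i|].
  - have [[Eu _] [Ev _]] := Fuv i.
    by apply: subfieldB => //; apply: subfieldM => //; apply: NE.
  - exact: Ls.
  - under eq_bigr do rewrite mulrC mulrBr mulrCA.
    by rewrite sumrB -mulr_sumr fv subrr.
have [i vi0] := sum_mul_neq0 v0.
have /eqP := e i; rewrite subr_eq0 => /eqP eu.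
suff [_ /= ef] : F f by rewrite /fixed /= ef.
rewrite -[f](mulfK vi0) -eu; have [Fu Fv] := Fuv i.
exact: subfield_div.
Qed.

End Descent.

(** * Transcendence degree *)

Section TranscendenceDegree.

(** A matrix with more rows than columns has a nonzero left kernel. *)
Lemma linear_relation (k : fieldType) (I J : finType) (C : I -> J -> k) :
  (#|J| < #|I|)%N ->
  exists2 r : I -> k, exists i, r i != 0 & forall j, \sum_i r i * C i j = 0.
Proof.
move=> JI.
pose B : 'M_(#|I|, #|J|) := \matrix_(i, j) C (enum_val i) (enum_val j).
have : kermx B != 0.
  rewrite kermx_eq0; apply: contraL JI => /eqP rB.
  by rewrite -leqNgt -[X in (X <= _)%N]rB rank_leq_col.
case/rowV0Pn => v /sub_kermxP vB v0.
exists (fun i => v 0 (enum_rank i)).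
  have /existsP[i vi] : [exists i, v 0 i != 0].
    apply: contraR v0 => /existsPn h; apply/eqP/rowP => i; rewrite mxE.
    by apply/eqP; rewrite -[_ == _]negbK h.
  by exists (enum_val i); rewrite enum_valK.
move=> j; have /rowP/(_ (enum_rank j)) := vB; rewrite !mxE => vBj; rewrite -[RHS]vBj.
rewrite (reindex (@enum_val I predT)) /=; last first.
  by exists enum_rank => ? _; [exact: enum_valK|exact: enum_rankK].
by apply: eq_bigr => i _; rewrite mxE enum_valK enum_rankK.
Qed.

Variables (k L : fieldType) (iota : {rmorphism k -> L}).

Definition generated_by n (xi : 'I_n -> L) : Prop :=
  forall f, exists P Q : {mpoly k[n]},
    mmap iota xi Q != 0 /\ f * mmap iota xi Q = mmap iota xi P.

(** [msize] is the degree plus one (and 0 at 0), so the bounds are [d] and [d * #|I|] on degrees. *)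
Lemma msize_prod_leq n (I : finType) (P : I -> {mpoly k[n]}) d :
  (forall i, (msize (P i) <= d.+1)%N) -> (msize (\prod_i P i) <= (d * #|I|).+1)%N.
Proof.
move=> hP; have -> : \prod_i P i = \prod_(i <- enum I) P i by rewrite big_enum.
rewrite cardE; elim: (enum I) => [|i s IH].
  by rewrite big_nil msize1.
rewrite big_cons /= mulnS; set q := \prod_(j <- s) P j in IH *.
have [->|p0] := eqVneq (P i) 0; first by rewrite mul0r msize0.
have [->|q0] := eqVneq q 0; first by rewrite mulr0 msize0.
rewrite msizeM //; apply: (@leq_trans (d.+1 + (d * size s).+1).-1).
  by rewrite -!subn1 leq_sub2r // leq_add.
by rewrite addSn addnS.
Qed.

(* The monomials of degree at most D in each of m elements, once multiplied by a
   common denominator, lie in the span of O(D^n) elements. *)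
Lemma alg_indep_leq n (xi : 'I_n -> L) m (t : m.-tuple L) :
  generated_by xi -> alg_indep iota t -> (m <= n)%N.
Proof.
move=> gen it; rewrite leqNgt; apply/negP => nm.
have [PQ hPQ] : {PQ : 'I_m -> {mpoly k[n]} * {mpoly k[n]} & forall i,
    mmap iota xi (PQ i).2 != 0 /\
    tnth t i * mmap iota xi (PQ i).2 = mmap iota xi (PQ i).1}.
  apply: (@choice _ _ (fun i pq => mmap iota xi pq.2 != 0 /\
    tnth t i * mmap iota xi pq.2 = mmap iota xi pq.1)) => i.
  by have [P [Q h]] := gen (tnth t i); exists (P, Q).
(* Over the common denominator [Q], each [t_i] is [R i / Q]. *)
pose Q := \prod_i (PQ i).2.
pose R i := (PQ i).1 * \prod_(j | j != i) (PQ j).2.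
have Q0 : mmap iota xi Q != 0.
  by rewrite rmorph_prod; apply/prodf_neq0 => i _; case: (hPQ i).
have tR i : tnth t i * mmap iota xi Q = mmap iota xi (R i).
  by rewrite /Q (bigD1 i) //= !rmorphM /= mulrA (hPQ i).2.
pose d := (\max_i maxn (msize (R i)) (msize Q))%N.
have dR i : (msize (R i) <= d.+1)%N.
  by apply: leqW; apply: leq_trans (leq_bigmax i); rewrite leq_maxl.
have m0 : (0 < m)%N by apply: leq_ltn_trans nm.
have dQ : (msize Q <= d.+1)%N.
  by apply: leqW; apply: leq_trans (leq_bigmax (Ordinal m0)); rewrite leq_maxr.
(* [e] bounds the degree of every [W a], and [e + 1 <= c (D + 1)]. With [D = c^n] and [n < m] this
   gives [(e + 1)^n <= D (D + 1)^n < (D + 1)^m]. *)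
pose c := (d * m).+1; pose D := (c ^ n)%N; pose e := (d * D * m)%N.
(* [W a] is the numerator of the monomial [t^a] over the denominator [Q ^ (D * m)], which is the
   same for all [a]. *)
pose W (a : {ffun 'I_m -> 'I_D.+1}) := \prod_i (R i ^+ a i * Q ^+ (D - a i)).
have mW a : (msize (W a) <= e.+1)%N.
  rewrite /e -[m in X in (_ <= X)%N]card_ord; apply: msize_prod_leq => i.
  (* Exactly [D] factors, each of degree at most [d]. *)
  have -> : R i ^+ a i * Q ^+ (D - a i)
     = \prod_(j < D) (if (j < a i)%N then R i else Q).
    rewrite -(big_mkord xpredT (fun j => if (j < a i)%N then R i else Q)).
    have aD : (a i <= D)%N by rewrite -ltnS.
    rewrite (big_cat_nat (n := a i)) //=; congr (_ * _).
      rewrite -[X in _ ^+ X]subn0 -prodr_const_nat; apply: eq_big_nat => j /andP[_ ->].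
      by [].
    rewrite -prodr_const_nat; apply: eq_big_nat => j /andP[h _].
    by rewrite ltnNge h.
  rewrite -[D in X in (_ <= X)%N]card_ord; apply: msize_prod_leq => j.
  by case: ifP.
have WE a : mmap iota xi (W a) = (\prod_i tnth t i ^+ a i) * mmap iota xi Q ^+ (D * m).
  rewrite rmorph_prod -[X in (D * X)%N]card_ord exprM -prodr_const -big_split.
  apply: eq_bigr => i _; rewrite rmorphM !rmorphXn /= -tR exprMn -mulrA -exprD subnKC //.
  by rewrite -ltnS.
(* There are [(D + 1)^m] polynomials [W a] and only [(e + 1)^n] coefficients to kill. *)
have [|r [a0 ra0] r0] := @linear_relation k {ffun 'I_m -> 'I_D.+1} {ffun 'I_n -> 'I_e.+1}
    (fun a b => (W a)@_[multinom (b i : nat) | i < n]).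
  rewrite !card_ffun !card_ord.
  have eD : (e.+1 <= c * D.+1)%N.
    by rewrite /e /c mulnAC mulSn addSn ltnS mulnS addnA leq_addl.
  apply: (@leq_ltn_trans ((c * D.+1) ^ n)).
    by case: {+}n => // n'; rewrite leq_exp2r.
  rewrite expnMn -/D; apply: (@leq_trans (D.+1 ^ n.+1)).
    by rewrite expnS ltn_pmul2r ?expn_gt0.
  by rewrite leq_pexp2l.
pose p : {mpoly k[m]} := \sum_a r a *: 'X_[[multinom (a i : nat) | i < m]].
suff p0 : p = 0.
  move/eqP: ra0; apply; have := congr1 (fun q => q@_[multinom (a0 i : nat) | i < m]) p0.
  rewrite mcoeff0 /p raddf_sum /= (bigD1 a0) //= mcoeffZ mcoeffX eqxx mulr1.
  rewrite big1 ?addr0 // => a aa0; rewrite mcoeffZ mcoeffX.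
  case: eqP => [/mnmP h|]; last by rewrite mulr0.
  by case/eqP: aa0; apply/ffunP => i; apply: val_inj; have := h i; rewrite !mnmE.
apply: it.
have rW : \sum_a r a *: W a = 0.
  apply/mpolyP => b; rewrite mcoeff0 raddf_sum /=.
  have [hb|hb] := boolP [forall i, b i < e.+1]%N.
    rewrite -[RHS](r0 [ffun i => inord (b i)]); apply: eq_bigr => a _.
    rewrite mcoeffZ; congr (_ * _@__); apply/mnmP => i.
    by rewrite mnmE ffunE inordK //; apply: (forallP hb).
  (* An exponent above [e] exceeds the degree of every [W a]. *)
  apply: big1 => a _; rewrite mcoeffZ memN_msupp_eq0 ?mulr0 //.
  apply: contra hb => /msize_mdeg_lt bW; apply/forallP => i.
  apply: leq_trans (mW a); apply: leq_ltn_trans bW.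
  by rewrite mdegE (bigD1 i) //= leq_addr.
apply: (mulIf (expf_neq0 (D * m) Q0)); rewrite mul0r.
rewrite -[RHS](rmorph0 (mmap iota xi)) -[X in _ = mmap _ _ X]rW.
rewrite !rmorph_sum mulr_suml; apply: eq_bigr => a _.
rewrite /= !mmapZ WE mulrA; congr (_ * _ * _).
by rewrite mmapX /mmap1; apply: eq_bigr => i _; rewrite mnmE.
Qed.

Lemma alg_indep0 (t : 0.-tuple L) : alg_indep iota t.
Proof.
move=> p; have -> : p = (p@_0)%:MP.
  apply/mpolyP => m; rewrite mcoeffC (_ : m = 0%MM) ?eqxx ?mulr1 //.
  by apply/mnmP => -[].
by rewrite mmapC => /eqP; rewrite fmorph_eq0 => /eqP ->; rewrite mpolyC0.
Qed.

(** [alg_indep_leq] bounds the sizes of independent families in [A]; one of the largest size is a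
    basis. *)
Lemma exists_transcendence_basis n (xi : 'I_n -> L) (A : set L) :
  generated_by xi -> exists m (t : m.-tuple L), transcendence_basis iota A t.
Proof.
move=> gen.
pose P m := `[< exists t : m.-tuple L, (forall i, A (tnth t i)) /\ alg_indep iota t >].
have exP : exists m, P m.
  exists 0%N; apply/asboolP; exists [tuple]; split; first by case.
  exact: alg_indep0.
have ub m : P m -> (m <= n)%N by move=> /asboolP[t [_]]; apply: alg_indep_leq.
case: (ex_maxnP exP ub) => m /asboolP[t [At it]] maxm.
exists m, t; split=> // a Aa iat.
suff /maxm : P m.+1 by rewrite ltnn.
apply/asboolP; exists [tuple of a :: t]; split=> // i.
by case: (unliftP ord0 i) => [j ->|->]; rewrite ?tnthS ?tnth0.
Qed.

(** Ensures that [trdeg] counts an actual basis and is not the default 0 of [xget]. *)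
Lemma trdegP n (xi : 'I_n -> L) (A : set L) : generated_by xi ->
  exists t : (trdeg iota A).-tuple L, transcendence_basis iota A t.
Proof.
move=> /(exists_transcendence_basis A) [m [t bt]].
by rewrite /trdeg; case: xgetP => [m' -> //|/(_ m)[]]; exists t.
Qed.

Lemma alg_indep_const m (t : m.-tuple L) i c :
  alg_indep iota t -> tnth t i <> iota c.
Proof.
move=> it ti; have h : 'X_i - c%:MP = 0 :> {mpoly k[m]}.
  by apply: it; rewrite rmorphB /= mmapX mmap1U mmapC ti subrr.
have := congr1 (fun p => p@_(U_(i))) h.
rewrite mcoeffB mcoeffX mcoeffC eqxx mnm1_eq0 mulr0 subr0 mcoeff0 => /eqP.
by rewrite oner_eq0.
Qed.

End TranscendenceDegree.

(** Algebraic closedness enters here: a one-variable relation splits into linear factors over [k],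
    so its root [a] would be a constant. *)
Lemma alg_indep_nonconstant (k : closedFieldType) (L : fieldType)
    (iota : {rmorphism k -> L}) (a : L) (t : 0.-tuple L) :
  ~ (exists c, a = iota c) -> alg_indep iota [tuple of a :: t].
Proof.
move=> na p pa0; apply: contrapT => /eqP p0; apply: na.
pose P : {poly k} := mmap polyC (fun=> 'X) p.
have PE : P = \sum_(m <- msupp p) p@_m *: 'X^(m ord0).
  rewrite /P /mmap; apply: eq_bigr => m _.
  by rewrite /mmap1 big_ord1 mul_polyC.
have Pa : (map_poly iota P).[a] = 0.
  rewrite -[RHS]pa0 PE rmorph_sum horner_sum /mmap; apply: eq_bigr => m _.
  by rewrite /= /mmap1 big_ord1 tnth0 map_polyZ hornerZ map_polyXn hornerXn.
have P0 : P != 0.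
  apply/eqP => /polyP h; move/eqP: p0; apply; apply/mpolyP => m; rewrite mcoeff0.
  have [mp|/memN_msupp_eq0//] := boolP (m \in msupp p).
  have := h (m ord0); rewrite coef0 PE coef_sum (bigD1_seq m) ?msupp_uniq //=.
  rewrite coefZ coefXn eqxx mulr1 big1 ?addr0 // => m' m'm.
  rewrite coefZ coefXn; case: eqP => [e|_]; last by rewrite mulr0.
  by case/eqP: m'm; apply/mnmP => i; rewrite ord1 e.
have [s Ps] := closed_field_poly_normal P.
have : root (map_poly iota P) a by apply/rootP.
rewrite Ps map_polyZ rootZ ?fmorph_eq0 ?lead_coef_eq0 // rmorph_prod.
rewrite /root horner_prod prodf_seq_eq0 => /hasP[z _ /=].
by rewrite map_polyXsubC hornerXsubC subr_eq0 => /eqP ->; exists z.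
Qed.

Lemma trdeg_eq0 (k : closedFieldType) (L : fieldType) (iota : {rmorphism k -> L})
    n (xi : 'I_n -> L) (A : set L) : generated_by iota xi ->
  trdeg iota A = 0%N <-> forall a, A a -> exists c, a = iota c.
Proof.
move=> /(trdegP A)[t [At it maxt]]; split=> [d0 a Aa|cA].
  apply: contrapT => na; apply: (maxt _ Aa).
  by move: t {At it maxt}; rewrite d0 => t; apply: alg_indep_nonconstant.
case: (trdeg iota A) t At it {maxt} => // m t At it.
have [c tc] := cA _ (At ord0).
by case: (alg_indep_const (i := ord0) (c := c) it).
Qed.

Section TrdegImage.
Variables (k L L' : fieldType) (iota : {rmorphism k -> L}) (iota' : {rmorphism k -> L'}).
Variable g : {rmorphism L -> L'}.
Hypothesis giota : forall c, g (iota c) = iota' c.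

Lemma alg_indep_map m (t : m.-tuple L) :
  alg_indep iota' (map_tuple g t) <-> alg_indep iota t.
Proof.
have e p : mmap iota' (tnth (map_tuple g t)) p = g (mmap iota (tnth t) p).
  rewrite /mmap rmorph_sum; apply: eq_bigr => m' _; rewrite rmorphM /= giota.
  congr (_ * _); rewrite /mmap1 rmorph_prod; apply: eq_bigr => i _.
  by rewrite tnth_map rmorphXn.
split=> it p; first by move=> h; apply: it; rewrite e h rmorph0.
by rewrite e => /eqP; rewrite fmorph_eq0 => /eqP; apply: it.
Qed.

(** Bases of [A] and of its image correspond under [g], so [xget] is applied to the same set of
    sizes. *)
Lemma trdeg_image (A : set L) : trdeg iota' (g @` A) = trdeg iota A.
Proof.
rewrite /trdeg; congr (xget _ _); apply/seteqP; split=> m.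
  move=> [t' [At' it' mt']].
  have [h hA] : {h : 'I_m -> L & forall i, A (h i) /\ g (h i) = tnth t' i}.
    apply: (@choice _ _ (fun i x => A x /\ g x = tnth t' i)) => i.
    by have [x Ax gx] := At' i; exists x.
  pose t := [tuple h i | i < m].
  have et : t' = map_tuple g t.
    by apply: eq_from_tnth => i; rewrite tnth_map tnth_mktuple (hA i).2.
  exists t; split=> [i||a Aa ia].
  - by rewrite tnth_mktuple; case: (hA i).
  - by apply/alg_indep_map; rewrite -et.
  - apply: (mt' (g a)); first by exists a.
    rewrite (_ : [tuple of _] = map_tuple g [tuple of a :: t]); first exact/alg_indep_map.
    by apply: val_inj; rewrite /= et.
move=> [t [At it mt]]; exists (map_tuple g t); split=> [i||_ [a Aa <-] ia].
- by rewrite tnth_map; exists (tnth t i).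
- exact/alg_indep_map.
- apply: (mt a Aa); apply/alg_indep_map; congr (alg_indep _ _): ia.
  exact: val_inj.
Qed.

End TrdegImage.

(** * Generic points and values of rational functions *)

Section GenericPoints.
Variable k : closedFieldType.
Implicit Types X Y Z : qpvar k.

(** Truth on a nonempty open subset, the complement of [W]. By irreducibility two such subsets meet,
    so generic properties can be combined. *)
Definition generic X (P : 'rV[k]_(ncoord X) -> Prop) : Prop :=
  exists W, [/\ zariski_closed W, ~ points X `<=` W &
    forall x, points X x -> ~ W x -> P x].

Lemma genericW X (P Q : 'rV[k]_(ncoord X) -> Prop) :
  (forall x, points X x -> P x -> Q x) -> generic P -> generic Q.
Proof. by move=> PQ [W [? ? WP]]; exists W; split=> // x Xx Wx; apply: PQ; [|apply: WP]. Qed.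

Lemma generic_and X (P Q : 'rV[k]_(ncoord X) -> Prop) :
  generic P -> generic Q -> generic (fun x => P x /\ Q x).
Proof.
move=> [W [cW nW WP]] [V [cV nV VQ]]; exists (W `|` V); split.
- exact: closedU.
- by move=> /((points_irreducible X).2 _ _ cW cV)[].
- by move=> x Xx /not_orP[? ?]; split; [apply: WP|apply: VQ].
Qed.

Lemma generic2 X (P Q R : 'rV[k]_(ncoord X) -> Prop) : generic P -> generic Q ->
  (forall x, points X x -> P x -> Q x -> R x) -> generic R.
Proof.
by move=> gP gQ h; apply: genericW (generic_and gP gQ) => x Xx [? ?]; apply: h.
Qed.

Lemma generic_exists X (P : 'rV[k]_(ncoord X) -> Prop) :
  generic P -> exists2 x, points X x & P x.
Proof.
move=> [W [_ nW WP]]; apply: contrapT => h; apply: nW => x Xx.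
by apply: contrapT => Wx; apply: h; exists x => //; apply: WP.
Qed.

Lemma generic_neq0 X d (p : {mpoly k[ncoord X]}) : p \is d.-homog ->
  nonvanishing p -> generic (fun x : 'rV[k]_(ncoord X) => p.@[x 0] != 0).
Proof.
move=> hp /nonvanishingP np.
exists [set x : 'rV[k]_(_) | x != 0 /\ p.@[x 0] = 0]; split=> //.
  exact: closedV hp.
by move=> x Xx h; apply/eqP => px; apply: h; split=> //; apply: qpvar_neq0 Xx.
Qed.

Lemma genericT X (P : 'rV[k]_(ncoord X) -> Prop) :
  (forall x, points X x -> P x) -> generic P.
Proof.
move=> h; apply: genericW (generic_neq0 (dhomog1 _ _) (nonvanishing1 X)) => x Xx _.
exact: h.
Qed.

Lemma generic_eq0 X d (p : {mpoly k[ncoord X]}) : p \is d.-homog ->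
  generic (fun x : 'rV[k]_(ncoord X) => p.@[x 0] = 0) ->
  forall x, points X x -> p.@[x 0] = 0.
Proof.
move=> hp g x Xx; apply: contrapT => /eqP px.
have np : nonvanishing p by exists x.
have [y _ [py /eqP]] := generic_exists (generic_and g (generic_neq0 hp np)).
by [].
Qed.

(* 0 is the junk value where the chosen denominator vanishes; only the values at
   generic points matter. *)
Definition ev X (f : ratfun X) (x : 'rV[k]_(ncoord X)) : k :=
  (hnum (repr f)).@[x 0] / (hden (repr f)).@[x 0].

Lemma hden_generic X (q : hfrac X) :
  generic (fun x : 'rV[k]_(ncoord X) => (hden q).@[x 0] != 0).
Proof. by have [d [_ dq]] := hfrac_homog q; apply: generic_neq0 dq (hden_nv q). Qed.

Lemma ev_pi X (q : hfrac X) :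
  generic (fun x => ev (\pi_(ratfun X) q)%qT x = (hnum q).@[x 0] / (hden q).@[x 0]).
Proof.
apply: generic2 (hden_generic q) (hden_generic (repr (\pi_(ratfun X) q)%qT)) _.
move=> x Xx q0 r0; apply/eqP; rewrite /ev eqr_div //; apply/eqP.
exact: hrepr_eq.
Qed.

(** Reduces identities in [k(X)] to generic values: after cross-multiplication a form vanishes
    generically, hence on all of [X]. *)
Lemma ev_inj X (f g : ratfun X) : generic (fun x => ev f x = ev g x) -> f = g.
Proof.
move=> h; rewrite -[f]reprK -[g]reprK; apply/ratfun_eqP => x Xx.
have [d [nf df]] := hfrac_homog (repr f); have [e [ng dg]] := hfrac_homog (repr g).
have hh : hnum (repr f) * hden (repr g) - hnum (repr g) * hden (repr f)
    \is (d + e).-homog.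
  by apply: rpredB; [|rewrite addnC]; apply: dhomogM.
apply/eqP; rewrite -subr_eq0 -!mevalM -mevalB; apply/eqP.
apply: (generic_eq0 hh) Xx.
apply: generic2 (generic_and (hden_generic (repr f)) (hden_generic (repr g))) h _.
move=> y _ [f0 g0] /eqP; rewrite /ev eqr_div // => /eqP e0.
by rewrite mevalB !mevalM e0 subrr.
Qed.

Lemma ev_const X c : generic (fun x => ev (ratconst X c) x = c).
Proof.
apply: genericW (ev_pi (hconst X c)) => x _ -> /=.
by rewrite mevalC meval1 divr1.
Qed.

Lemma evD X (f g : ratfun X) : generic (fun x => ev (f + g) x = ev f x + ev g x).
Proof.
have h := ev_pi (hadd (repr f) (repr g)).
apply: generic2 (generic_and (hden_generic (repr f)) (hden_generic (repr g))) h _.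
move=> x _ [f0 g0]; rewrite -radd_pi !reprK => ->.
by rewrite /= !(mevalM, mevalD) addf_div.
Qed.

Lemma evM X (f g : ratfun X) : generic (fun x => ev (f * g) x = ev f x * ev g x).
Proof.
apply: genericW (ev_pi (hmul (repr f) (repr g))).
by move=> x _; rewrite -rmul_pi !reprK => ->; rewrite /= !mevalM mulf_div.
Qed.

Lemma ev0 X : generic (fun x => ev (0 : ratfun X) x = 0).
Proof. by have := ev_const X 0; rewrite rmorph0. Qed.

Lemma ev1 X : generic (fun x => ev (1 : ratfun X) x = 1).
Proof. by have := ev_const X 1; rewrite rmorph1. Qed.

Lemma ev_sum X (I : Type) (s : seq I) (f : I -> ratfun X) :
  generic (fun x => ev (\sum_(i <- s) f i) x = \sum_(i <- s) ev (f i) x).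
Proof.
elim: s => [|i s IH].
  by apply: genericW (ev0 X) => x _ ex; rewrite !big_nil.
apply: generic2 IH (evD (f i) (\sum_(j <- s) f j)) _ => x _ e1 e2.
by rewrite !big_cons e2 e1.
Qed.

Lemma ev_prod X (I : Type) (s : seq I) (f : I -> ratfun X) :
  generic (fun x => ev (\prod_(i <- s) f i) x = \prod_(i <- s) ev (f i) x).
Proof.
elim: s => [|i s IH].
  by apply: genericW (ev1 X) => x _ ex; rewrite !big_nil.
apply: generic2 IH (evM (f i) (\prod_(j <- s) f j)) _ => x _ e1 e2.
by rewrite !big_cons e2 e1.
Qed.

Lemma ev_exp X (f : ratfun X) n : generic (fun x => ev (f ^+ n) x = ev f x ^+ n).
Proof.
apply: genericW (ev_prod (iota 0 n) (fun=> f)) => x _.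
by rewrite !big_const_seq !count_predT !size_iota -!Monoid.iteropE.
Qed.

Lemma generic_all X (I : eqType) (s : seq I) (P : I -> 'rV[k]_(ncoord X) -> Prop) :
  (forall i, generic (P i)) -> generic (fun x => forall i, i \in s -> P i x).
Proof.
move=> gP; elim: s => [|i s IH]; first exact: genericT.
apply: generic2 IH (gP i) _ => x _ h Pi j; rewrite inE.
by move=> /orP[/eqP ->|/h].
Qed.

Lemma generic_allT X (I : finType) (P : I -> 'rV[k]_(ncoord X) -> Prop) :
  (forall i, generic (P i)) -> generic (fun x => forall i, P i x).
Proof.
move=> gP; apply: genericW (generic_all (index_enum I) gP) => x _ h i.
by apply: h; rewrite mem_index_enum.
Qed.

Lemma ev_mmap X n (xi : 'I_n -> ratfun X) (p : {mpoly k[n]}) :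
  generic (fun x => ev (mmap (ratconst X) xi p) x = p.@[fun i => ev (xi i) x]).
Proof.
have h1 := generic_all (msupp p) (fun m => ev_const X p@_m).
have h2 := generic_all (msupp p) (fun m => evM (ratconst X p@_m) (mmap1 xi m)).
have h3 := generic_all (msupp p) (fun m => ev_prod (index_enum 'I_n) (fun i => xi i ^+ m i)).
have h4 := generic_all (msupp p) (fun m => generic_allT (fun i => ev_exp (xi i) (m i))).
have h5 := ev_sum (msupp p) (fun m => ratconst X p@_m * mmap1 xi m).
apply: generic2 (generic_and (generic_and h1 h2) (generic_and h3 h4)) h5 _.
move=> x _ [[e1 e2] [e3 e4]] e5; rewrite /mmap e5 mevalE !big_seq.
apply: eq_bigr => m mp; rewrite e2 // e1 //; congr (_ * _).
by rewrite /mmap1 e3 //; apply: eq_bigr => i _; rewrite e4.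
Qed.

Lemma ev_neq0 X (f : ratfun X) : f != 0 -> generic (fun x => ev f x != 0).
Proof.
move=> f0; apply: generic2 (generic_and (evM f f^-1) (ev1 X)) (ev1 X) _.
move=> x _ [e1 e2] _; apply: contraTneq (oner_neq0 k) => ex.
by rewrite -e2 -(divff f0) e1 ex mul0r eqxx.
Qed.

(** Equality of projective points in homogeneous coordinates. Maps on products are computed only up
    to such a scalar, which [ev] does not see. *)
Definition proj_eq n (v w : 'rV[k]_n) : Prop := exists2 c, c != 0 & v = c *: w.

Lemma proj_eq_refl n (v : 'rV[k]_n) : proj_eq v v.
Proof. by exists 1; rewrite ?oner_neq0 ?scale1r. Qed.

Lemma proj_eq_sym n (v w : 'rV[k]_n) : proj_eq v w -> proj_eq w v.
Proof.
move=> [c c0 ->]; exists c^-1; first by rewrite invr_eq0.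
by rewrite scalerA mulVf // scale1r.
Qed.

Lemma proj_eq_trans n (v u w : 'rV[k]_n) : proj_eq u v -> proj_eq v w -> proj_eq u w.
Proof.
move=> [c c0 ->] [d d0 ->]; exists (c * d); first by rewrite mulf_neq0.
by rewrite scalerA.
Qed.

Lemma proj_eq_scale n c (v : 'rV[k]_n) : c != 0 -> proj_eq (c *: v) v.
Proof. by exists c. Qed.

Lemma ev_proj_eq X (f : ratfun X) v w : proj_eq v w -> ev f v = ev f w.
Proof.
move=> [c c0 ->]; have [d [nf df]] := hfrac_homog (repr f).
rewrite /ev (mevalZrow _ _ nf) (mevalZrow _ _ df) -mulf_div divff ?mul1r //.
exact: expf_neq0.
Qed.

Section Maps.
Variables (X Y : qpvar k) (f : dratmap X Y).

Definition rmap (x : 'rV[k]_(ncoord X)) := rmap_eval (rforms f) x.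

(** The exceptional set [W] pulls back to the closed set [V] of the composed forms; if [V] contained
    [X], dominance would put [Y] inside [W]. *)
Lemma generic_rmap (P : 'rV[k]_(ncoord Y) -> Prop) :
  generic P -> generic (fun x => points Y (rmap x) /\ P (rmap x)).
Proof.
move=> [W [[S hS ->] nW WP]]; have [[e hF] [U [cU nU UY]]] := dratmap_ratmap f.
pose V := zeros [set q | exists2 p, S p & q = p \mPo rforms f].
have cV : zariski_closed V.
  exists [set q | exists2 p, S p & q = p \mPo rforms f] => // _ [p /hS[d hd] ->].
  by exists (e * d)%N; apply: dhomog_comp.
have VE x : V x <-> x != 0 /\ forall p, S p -> p.@[rmap x 0] = 0.
  split=> -[x0 h]; split=> //.
    by move=> p Sp; rewrite -meval_rmap; apply: h; exists p.
  by move=> _ [p Sp ->]; rewrite meval_rmap; apply: h.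
have nV : ~ points X `<=` V.
  move=> XV; apply: nW; apply: (dratmap_dominant (d := f)); first by exists S.
  move=> x Xx Yfx; split; first exact: qpvar_neq0 Yfx.
  by have /VE[] := XV _ Xx.
exists (U `|` V); split.
- exact: closedU.
- by move=> /((points_irreducible X).2 _ _ cU cV)[].
- move=> x Xx /not_orP[Ux Vx]; have Yfx := UY _ Xx Ux; split=> //.
  apply: WP => // -[_ h]; apply: Vx; apply/VE; split=> //.
  exact: qpvar_neq0 Xx.
Qed.

Lemma ev_pullback (g : ratfun Y) :
  generic (fun x => ev (pullback f g) x = ev g (rmap x)).
Proof.
apply: genericW (ev_pi (hpull f (repr g))) => x _.
by rewrite -pullback_pi reprK => -> /=; rewrite !meval_rmap.
Qed.

Lemma rmap_proj_eq v w : proj_eq v w -> proj_eq (rmap v) (rmap w).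
Proof.
move=> [c c0 ->]; have [[d hd] _] := dratmap_ratmap f.
exists (c ^+ d); first exact: expf_neq0.
by apply/rowP => i; rewrite !mxE (mevalZrow _ _ (hd i)).
Qed.

End Maps.

(** Composites are compared at generic points, so a commuting square can be used without composing
    tuples of forms. *)
Lemma pullback_comp X Y Y' Z (f : dratmap X Y) (g : dratmap Y Z)
    (f' : dratmap X Y') (g' : dratmap Y' Z) u :
  generic (fun x => proj_eq (rmap g (rmap f x)) (rmap g' (rmap f' x))) ->
  pullback f (pullback g u) = pullback f' (pullback g' u).
Proof.
move=> h; apply: ev_inj.
have e1 := generic_and (ev_pullback f (pullback g u)) (generic_rmap f (ev_pullback g u)).
have e2 := generic_and (ev_pullback f' (pullback g' u)) (generic_rmap f' (ev_pullback g' u)).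
apply: generic2 (generic_and e1 e2) h _ => x _ [[-> [_ ->]] [-> [_ ->]]].
exact: ev_proj_eq.
Qed.

Section Identity.
Variable X : qpvar k.

Definition id_forms : (ncoord X).-tuple {mpoly k[ncoord X]} := [tuple 'X_i | i < ncoord X].

Lemma id_formsE x : rmap_eval id_forms x = x.
Proof. by apply/rowP => i; rewrite mxE tnth_mktuple mevalXU. Qed.

Lemma id_ratmap : is_ratmap id_forms.
Proof.
split; first by exists 1%N => i; rewrite tnth_mktuple dhomog_var.
have [W [? ? h]] : generic (points X) by apply: genericT.
by exists W; split=> // x Xx Wx; rewrite id_formsE.
Qed.

Lemma id_dominant : is_dominant id_forms.
Proof. by move=> Z cZ h x Xx; have := h x Xx; rewrite id_formsE; apply. Qed.

Definition id_map : dratmap X X := DRatMap id_ratmap id_dominant.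

Lemma rmap_id x : rmap id_map x = x. Proof. exact: id_formsE. Qed.

Lemma pullback_id u : pullback id_map u = u.
Proof.
by apply: ev_inj; apply: genericW (ev_pullback id_map u) => x _ ->; rewrite rmap_id.
Qed.

End Identity.

(* The coordinates used by prod_forms to recover x and y from segre x y. *)
Definition good X (x : 'rV[k]_(ncoord X)) : Prop := x 0 (Defs.coord X) != 0.

Lemma generic_good X : generic (@good X).
Proof.
have := generic_neq0 (dhomog_var k (Defs.coord X)) (coordP X).
by apply: genericW => x _; rewrite mevalXU.
Qed.

Section Product.
Variables X Y : qpvar k.
Let n := ncoord X.
Let m := ncoord Y.

Lemma segreZr c (x : 'rV[k]_n) (y : 'rV[k]_m) : segre x (c *: y) = c *: segre x y.
Proof.
by apply/rowP => l; case/mxvec_indexP: l => i j; rewrite mxE !segreE mxE mulrCA.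
Qed.

Lemma segre_proj_eq (x x' : 'rV[k]_n) (y y' : 'rV[k]_m) :
  proj_eq x x' -> proj_eq y y' -> proj_eq (segre x y) (segre x' y').
Proof.
move=> [c c0 ->] [d d0 ->]; exists (d * c); first by rewrite mulf_neq0.
by rewrite segreZr segreZl scalerA.
Qed.

Lemma generic_fst (P : 'rV[k]_n -> Prop) (R : 'rV[k]_(n * m) -> Prop) : @generic X P ->
  (forall x y, points X x -> points Y y -> P x -> R (segre x y)) ->
  @generic (prod_var X Y) R.
Proof.
move=> [W [cW nW WP]] PR.
exists (prod_points W [set y : 'rV[k]_m | y != 0]); split.
- by apply: closed_prod => //; apply: closedn0.
- have [[y Yy] _] := points_irreducible Y; move=> h; apply: nW => x Xx.
  have [|[x' y'] /= [Wx' _] e] := h (segre x y); first by exists (x, y).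
  have xn0 := qpvar_neq0 Xx; have yn0 := qpvar_neq0 Yy.
  have [c [_ [c0 _ -> _]]] := segre_inj (esym e) xn0 yn0.
  exact: closed_scale.
- move=> _ [[x y] /= [Xx Yy] <-] nxy; apply: PR => //; apply: WP => // Wx.
  by apply: nxy; exists (x, y) => //; split=> //; apply: qpvar_neq0 Yy.
Qed.

Lemma generic_snd (P : 'rV[k]_m -> Prop) (R : 'rV[k]_(n * m) -> Prop) : @generic Y P ->
  (forall x y, points X x -> points Y y -> P y -> R (segre x y)) ->
  @generic (prod_var X Y) R.
Proof.
move=> [W [cW nW WP]] PR.
exists (prod_points [set x : 'rV[k]_n | x != 0] W); split.
- by apply: closed_prod => //; apply: closedn0.
- have [[x Xx] _] := points_irreducible X; move=> h; apply: nW => y Yy.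
  have [|[x' y'] /= [_ Wy'] e] := h (segre x y); first by exists (x, y).
  have xn0 := qpvar_neq0 Xx; have yn0 := qpvar_neq0 Yy.
  have [_ [c [_ c0 _ ->]]] := segre_inj (esym e) xn0 yn0.
  exact: closed_scale.
- move=> _ [[x y] /= [Xx Yy] <-] nxy; apply: PR => //; apply: WP => // Wy.
  by apply: nxy; exists (x, y) => //; split=> //; apply: qpvar_neq0 Xx.
Qed.

Lemma generic_prod (P : 'rV[k]_n -> Prop) (Q : 'rV[k]_m -> Prop)
    (R : 'rV[k]_(n * m) -> Prop) : @generic X P -> @generic Y Q ->
  (forall x y, points X x -> points Y y -> P x -> Q y -> R (segre x y)) ->
  @generic (prod_var X Y) R.
Proof.
move=> gP gQ PQR.
move: gP gQ => [W1 [cW1 nW1 WP]] [W2 [cW2 nW2 WQ]].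
(* [z] determines [x] and [y] only up to scalars, and [P] may depend on the scalar; the closed set
   [W1] does not, so the argument goes through its complement. *)
have g1 : @generic (prod_var X Y) (fun z => forall x y, points X x -> points Y y ->
    z = segre x y -> P x).
  apply: (@generic_fst (fun x => ~ W1 x)) => [|x y Xx Yy Wx x' y' Xx' Yy' e].
    by exists W1.
  apply: WP => // Wx'; apply: Wx.
  have [c [_ [c0 _ -> _]]] := segre_inj e (qpvar_neq0 Xx) (qpvar_neq0 Yy).
  exact: closed_scale.
have g2 : @generic (prod_var X Y) (fun z => forall x y, points X x -> points Y y ->
    z = segre x y -> Q y).
  apply: (@generic_snd (fun y => ~ W2 y)) => [|x y Xx Yy Wy x' y' Xx' Yy' e].
    by exists W2.
  apply: WQ => // Wy'; apply: Wy.
  have [_ [c [_ c0 _ ->]]] := segre_inj e (qpvar_neq0 Xx) (qpvar_neq0 Yy).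
  exact: closed_scale.
apply: generic2 g1 g2 _ => _ [[x y] /= [Xx Yy] <-] Px Qy.
by apply: PQR => //; [apply: Px Yy _|apply: Qy Xx _ _].
Qed.

(** Slices of the exceptional set [W] are closed. Keep the [y] with [(x0, y)] outside [W], for one
    fixed [x0]; then [x0] shows that the slice over [y] is not all of [X]. *)
Lemma generic_fubini (R : 'rV[k]_(n * m) -> Prop) : @generic (prod_var X Y) R ->
  @generic Y (fun y => @generic X (fun x => R (segre x y))).
Proof.
move=> [W [cW nW WR]].
have [x0 [y0 [Xx0 Yy0 Wxy0]]] : exists x y, [/\ points X x, points Y y & ~ W (segre x y)].
  apply: contrapT => h; apply: nW => _ [[x y] /= [Xx Yy] <-].
  by apply: contrapT => Wxy; apply: h; exists x, y.
exists [set y | W (segre x0 y)]; split.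
- exact: closed_slicer (qpvar_neq0 Xx0).
- by move=> /(_ _ Yy0).
move=> y Yy Wxy; exists [set x | W (segre x y)]; split.
- exact: closed_slicel (qpvar_neq0 Yy).
- by move=> /(_ _ Xx0).
- by move=> x Xx Wx; apply: WR => //; exists (x, y).
Qed.

End Product.

End GenericPoints.

(** * Products of rational maps and generators of function fields *)

Section ProductsOfMaps.
Variable k : closedFieldType.
Implicit Types X Y Z : qpvar k.

Section Projections.
Variables X Y : qpvar k.
Let n := ncoord X.
Let m := ncoord Y.

Definition fst_forms : (ncoord X).-tuple {mpoly k[ncoord (prod_var X Y)]} :=
  segre_col k (ncoord X) (Defs.coord Y).
Definition snd_forms : (ncoord Y).-tuple {mpoly k[ncoord (prod_var X Y)]} :=
  segre_row k (ncoord Y) (Defs.coord X).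

Lemma fst_formsE (x : 'rV[k]_n) (y : 'rV[k]_m) :
  @rmap_eval k (prod_var X Y) X fst_forms (segre x y) = y 0 (Defs.coord Y) *: x.
Proof. by apply/rowP => i; rewrite !mxE tnth_mktuple mevalXU segreE mulrC. Qed.

Lemma snd_formsE (x : 'rV[k]_n) (y : 'rV[k]_m) :
  @rmap_eval k (prod_var X Y) Y snd_forms (segre x y) = x 0 (Defs.coord X) *: y.
Proof. by apply/rowP => i; rewrite !mxE tnth_mktuple mevalXU segreE. Qed.

Lemma fst_ratmap : @is_ratmap k (prod_var X Y) X fst_forms.
Proof.
split; first by exists 1%N => j; apply: segre_col_homog.
have [W [cW nW WP]] : @generic k (prod_var X Y)
    (fun z => points X (@rmap_eval k (prod_var X Y) X fst_forms z)).
  apply: generic_snd (@generic_good k Y) _ => x y Xx _ gy.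
  by rewrite fst_formsE; apply: qpvar_scale.
by exists W.
Qed.

Lemma snd_ratmap : @is_ratmap k (prod_var X Y) Y snd_forms.
Proof.
split; first by exists 1%N => j; apply: segre_row_homog.
have [W [cW nW WP]] : @generic k (prod_var X Y)
    (fun z => points Y (@rmap_eval k (prod_var X Y) Y snd_forms z)).
  apply: generic_fst (@generic_good k X) _ => x y _ Yy gx.
  by rewrite snd_formsE; apply: qpvar_scale.
by exists W.
Qed.

Lemma fst_dominant : @is_dominant k (prod_var X Y) X fst_forms.
Proof.
move=> Z cZ h x Xx; have [y Yy gy] := generic_exists (@generic_good k Y).
have := h (segre x y); rewrite fst_formsE => /(_ _ (qpvar_scale gy Xx)) Zx.
rewrite -[x]scale1r -(mulVf gy) -scalerA; apply: closed_scale; rewrite ?invr_eq0 //.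
by apply: Zx; exists (x, y).
Qed.

Lemma snd_dominant : @is_dominant k (prod_var X Y) Y snd_forms.
Proof.
move=> Z cZ h y Yy; have [x Xx gx] := generic_exists (@generic_good k X).
have := h (segre x y); rewrite snd_formsE => /(_ _ (qpvar_scale gx Yy)) Zy.
rewrite -[y]scale1r -(mulVf gx) -scalerA; apply: closed_scale; rewrite ?invr_eq0 //.
by apply: Zy; exists (x, y).
Qed.

Definition fst_map : dratmap (prod_var X Y) X := DRatMap fst_ratmap fst_dominant.
Definition snd_map : dratmap (prod_var X Y) Y := DRatMap snd_ratmap snd_dominant.

Lemma rmap_fst (x : 'rV[k]_n) (y : 'rV[k]_m) :
  good y -> proj_eq (rmap fst_map (segre x y)) x.
Proof. by move=> gy; rewrite /rmap fst_formsE; apply: proj_eq_scale. Qed.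

Lemma rmap_snd (x : 'rV[k]_n) (y : 'rV[k]_m) :
  good x -> proj_eq (rmap snd_map (segre x y)) y.
Proof. by move=> gx; rewrite /rmap snd_formsE; apply: proj_eq_scale. Qed.

End Projections.

Section ProductMaps.
Variables (X Y X' Y' : qpvar k) (f : dratmap X X') (g : dratmap Y Y').

Lemma rmap_prod (x : 'rV[k]_(ncoord X)) (y : 'rV[k]_(ncoord Y)) :
  good x -> good y -> proj_eq (rmap (prod_map f g) (segre x y)) (segre (rmap f x) (rmap g y)).
Proof.
move=> gx gy; have [[d hf] _] := dratmap_ratmap f; have [[e hg] _] := dratmap_ratmap g.
rewrite /rmap (prod_mapE _ _ hf hg); apply: proj_eq_scale.
by rewrite mulf_neq0 ?expf_neq0.
Qed.

Lemma generic_rmap_fst_prod : @generic k (prod_var X Y) (fun z =>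
  proj_eq (rmap (fst_map X' Y') (rmap (prod_map f g) z)) (rmap f (rmap (fst_map X Y) z))).
Proof.
have gY := generic_and (@generic_good k Y) (generic_rmap g (@generic_good k Y')).
apply: generic_prod (@generic_good k X) gY _ => x y _ _ gx [gy [_ ggy]].
apply: proj_eq_trans (rmap_proj_eq _ (rmap_prod gx gy)) _.
apply: proj_eq_trans (rmap_fst _ ggy) _.
by apply: rmap_proj_eq; apply: proj_eq_sym; apply: rmap_fst.
Qed.

Lemma generic_rmap_snd_prod : @generic k (prod_var X Y) (fun z =>
  proj_eq (rmap (snd_map X' Y') (rmap (prod_map f g) z)) (rmap g (rmap (snd_map X Y) z))).
Proof.
have gX := generic_and (@generic_good k X) (generic_rmap f (@generic_good k X')).
apply: generic_prod gX (@generic_good k Y) _ => x y _ _ [gx [_ gfx]] gy.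
apply: proj_eq_trans (rmap_proj_eq _ (rmap_prod gx gy)) _.
apply: proj_eq_trans (rmap_snd _ gfx) _.
by apply: rmap_proj_eq; apply: proj_eq_sym; apply: rmap_snd.
Qed.

Lemma pullback_prod_fst u :
  pullback (prod_map f g) (pullback (fst_map X' Y') u) = pullback (fst_map X Y) (pullback f u).
Proof. exact: pullback_comp generic_rmap_fst_prod. Qed.

Lemma pullback_prod_snd u :
  pullback (prod_map f g) (pullback (snd_map X' Y') u) = pullback (snd_map X Y) (pullback g u).
Proof. exact: pullback_comp generic_rmap_snd_prod. Qed.

End ProductMaps.

(** Yields the commutation of [s] with [t], and of [r] and [s] with [p1] and [p2], in
    [invariants_prod]. *)
Lemma pullback_prod_comp X Y X1 Y1 X2 Y2 X3 Y3
    (f : dratmap X X1) (g : dratmap Y Y1) (f' : dratmap X1 X3) (g' : dratmap Y1 Y3)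
    (h : dratmap X X2) (l : dratmap Y Y2) (h' : dratmap X2 X3) (l' : dratmap Y2 Y3) u :
  generic (fun x => proj_eq (rmap f' (rmap f x)) (rmap h' (rmap h x))) ->
  generic (fun y => proj_eq (rmap g' (rmap g y)) (rmap l' (rmap l y))) ->
  pullback (prod_map f g) (pullback (prod_map f' g') u) =
  pullback (prod_map h l) (pullback (prod_map h' l') u).
Proof.
move=> gX gY; apply: pullback_comp.
have goodX := generic_and (@generic_good k X)
  (generic_and (generic_rmap f (@generic_good k X1)) (generic_rmap h (@generic_good k X2))).
have goodY := generic_and (@generic_good k Y)
  (generic_and (generic_rmap g (@generic_good k Y1)) (generic_rmap l (@generic_good k Y2))).
apply: generic_prod (generic_and goodX gX) (generic_and goodY gY) _ => x y _ _.
move=> [[gx [[_ gfx] [_ ghx]]] ex] [[gy [[_ ggy] [_ gly]]] ey].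
apply: proj_eq_trans (rmap_proj_eq _ (rmap_prod f g gx gy)) _.
apply: proj_eq_trans (rmap_prod f' g' gfx ggy) _.
apply: proj_eq_trans (segre_proj_eq ex ey) _; apply: proj_eq_sym.
apply: proj_eq_trans (rmap_proj_eq (prod_map h' l') (rmap_prod h l gx gy)) _.
exact: rmap_prod.
Qed.

Section Coordinates.
Variables (X : qpvar k) (a : 'I_(ncoord X)) (nva : @nonvanishing _ X 'X_a).

Definition coord_frac (i : 'I_(ncoord X)) : hfrac X.
Proof.
refine (@HFrac _ X 'X_i 'X_a _ nva).
by exists 1%N; split; apply: dhomog_var.
Defined.

Definition coord_fun i : ratfun X := (\pi_(ratfun X) (coord_frac i))%qT.

Lemma ev_coord_fun : generic (fun x : 'rV[k]_(ncoord X) =>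
  x 0 a != 0 /\ forall i, ev (coord_fun i) x = x 0 i / x 0 a).
Proof.
apply: generic2 (generic_neq0 (dhomog_var k a) nva)
  (generic_allT (fun i => ev_pi (coord_frac i))) _ => x _ xa h.
rewrite mevalXU in xa; split=> // i.
by rewrite h /= !mevalXU.
Qed.

(** Dehomogenisation: a form of degree [d] in the functions [x_i / x_a] is the form divided by
    [x_a^d], a factor common to numerator and denominator. *)
Lemma coord_fun_generates : generated_by (ratconst X) coord_fun.
Proof.
move=> f; exists (hnum (repr f)), (hden (repr f)).
set P := hnum _; set Q := hden _.
have [d [hP hQ]] := hfrac_homog (repr f).
have evE (p : {mpoly k[ncoord X]}) : p \is d.-homog -> generic (fun x : 'rV[k]_(ncoord X) =>
    x 0 a != 0 /\ ev (mmap (ratconst X) coord_fun p) x = (x 0 a)^-1 ^+ d * p.@[x 0]).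
  move=> hp; apply: generic2 ev_coord_fun (ev_mmap coord_fun p) _ => x _ [xa h] ->.
  split=> //; rewrite -(meval_scale _ _ hp); apply: meval_ext => i.
  by rewrite h mulrC.
have [eP eQ] := (evE _ hP, evE _ hQ); have nQ := hden_generic (repr f); split.
  apply/eqP => Q0; rewrite Q0 in eQ.
  have [x _ [[xa ex] [Qx e0]]] := generic_exists (generic_and eQ (generic_and nQ (ev0 X))).
  move: ex; rewrite e0 => /esym/eqP; apply/negP.
  by rewrite mulf_neq0 ?expf_neq0 ?invr_eq0.
apply: ev_inj; apply: generic2 (generic_and eP eQ)
  (generic_and nQ (evM f (mmap (ratconst X) coord_fun Q))) _.
move=> x _ [[xa ->] [_ eQx]] [Qx ->].
by rewrite eQx /ev -/P -/Q mulrCA [P.@[_] / _ * _]mulrC; congr (_ * _); rewrite mulrC divfK.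
Qed.

End Coordinates.

End ProductsOfMaps.

(** * Invariants of products *)

Section InvariantsOfProducts.
Variable k : closedFieldType.
Implicit Types X Y Z : qpvar k.

Lemma generic_segre X Y P Q : @generic k X P -> @generic k Y Q ->
  @generic k (prod_var X Y) (fun z => exists x y,
    [/\ points X x, points Y y, P x, Q y & z = segre x y]).
Proof. by move=> gP gQ; apply: generic_prod gP gQ _ => x y Xx Yy Px Qy; exists x, y. Qed.

Lemma nonvanishing_coord_prod X Y (i : 'I_(ncoord X)) (j : 'I_(ncoord Y)) :
  @nonvanishing _ (prod_var X Y) 'X_(mxvec_index i j) ->
  @nonvanishing _ X 'X_i /\ @nonvanishing _ Y 'X_j.
Proof.
move=> [_ [[x y] /= [Xx Yy] <-]]; rewrite mevalXU segreE mulf_eq0 negb_or => /andP[xi yj].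
by split; [exists x|exists y]; rewrite ?mevalXU.
Qed.

(** In Segre coordinates [z_ij / z_i0j0] is the product of [x_i / x_i0] and [y_j / y_j0], and these
    quotients generate [k(X x Y)]. *)
Lemma compositum_prod X Y (f : ratfun (prod_var X Y)) :
  compositum (range (pullback (fst_map X Y))) (range (pullback (snd_map X Y))) f.
Proof.
set K := range _; set L := range _.
have sK : subfield K by apply: subfield_range.
have sL : subfield L by apply: subfield_range.
have [l nl] := coord_exists (prod_var X Y).
have [i0 [j0 el]] : exists i j, l = mxvec_index i j.
  by case/mxvec_indexP: l {nl} => i j; exists i, j.
have [nX nY] : @nonvanishing _ X 'X_i0 /\ @nonvanishing _ Y 'X_j0.
  by apply: nonvanishing_coord_prod; rewrite -el.
have coordR i : sumprod K L (coord_fun nl i).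
  case/mxvec_indexP: i => i j.
  have -> : coord_fun nl (mxvec_index i j) =
      pullback (fst_map X Y) (coord_fun nX i) * pullback (snd_map X Y) (coord_fun nY j).
    apply: ev_inj.
    have gX := generic_and (@generic_good k X) (ev_coord_fun nX).
    have gY := generic_and (@generic_good k Y) (ev_coord_fun nY).
    apply: generic2 (generic_and (generic_segre gX gY) (ev_coord_fun nl))
      (generic_and (evM (pullback (fst_map X Y) (coord_fun nX i))
                        (pullback (snd_map X Y) (coord_fun nY j)))
        (generic_and (ev_pullback (fst_map X Y) (coord_fun nX i))
                     (ev_pullback (snd_map X Y) (coord_fun nY j)))) _.
    move=> _ _ [[x [y [_ _ [gx [_ ex]] [gy [_ ey]] ->]]] [_ ->]] [-> [-> ->]].
    rewrite (ev_proj_eq _ (rmap_fst _ gy)) (ev_proj_eq _ (rmap_snd _ gx)) ex ey.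
    by rewrite el !segreE mulf_div.
  by apply: sumprod1; [exists (coord_fun nX i)|exists (coord_fun nY j)].
have constR c : sumprod K L (ratconst (prod_var X Y) c).
  rewrite -[ratconst _ c]mulr1; apply: sumprod1; last exact: subfield1.
  by exists (ratconst X c); rewrite ?pullback_const.
have R1 : sumprod K L 1 by have := constR 1; rewrite rmorph1.
have R0 : sumprod K L 0 by have := constR 0; rewrite rmorph0.
have polyR (p : {mpoly k[_]}) : sumprod K L (mmap (ratconst _) (coord_fun nl) p).
  rewrite /mmap; elim/big_ind: _ => // [x y|m _]; first exact: sumprodD.
  apply: sumprodM => //; rewrite /mmap1; elim/big_ind: _ => // [x y|i _].
    exact: sumprodM.
  by elim: (m i) => [|d IH]; rewrite ?expr0 // exprS; apply: sumprodM.
have [P [Q [Q0 fQ]]] := coord_fun_generates nl f.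
by exists (mmap (ratconst _) (coord_fun nl) P), (mmap (ratconst _) (coord_fun nl) Q).
Qed.

(** Instance of [fixed_compositum] with [E = k(X)] and [F = k(Y)]: by hypothesis the fixed elements
    of [E] are constants, so they lie in [F]. *)
Lemma fixed_prod_id X Y (g : dratmap X X) :
  (forall a, pullback g a = a -> exists c, a = ratconst X c) ->
  forall f, pullback (prod_map g (id_map Y)) f = f -> range (pullback (snd_map X Y)) f.
Proof.
move=> gconst f ff; set s := pullback (prod_map g (id_map Y)).
apply: (fixed_compositum (s := s) (E := range (pullback (fst_map X Y)))).
- exact: subfield_range.
- by move=> _ [a _ <-]; rewrite /= /s pullback_prod_fst; exists (pullback g a).
- exact: subfield_range.
- by move=> _ [b _ <-]; rewrite /fixed /s /= pullback_prod_snd pullback_id.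
- move=> _ [[a _ <-]]; rewrite /fixed /s /= pullback_prod_fst => /fmorph_inj/gconst[c ->].
  by exists (ratconst Y c); rewrite ?pullback_const.
- exact: compositum_prod.
- exact: ff.
Qed.

(** If [m i1] were nonzero, fixing [(x', y)] outside its zeros would turn the relation
    [sum a_i(x) m_i(x', y) = 0] into a nontrivial one over [k] between the [a i]. *)
Lemma pullback_prod_independent X X' Y (I : finType) (a : I -> ratfun X)
    (m : I -> ratfun (prod_var X' Y)) :
  (forall c : I -> k, \sum_i ratconst X (c i) * a i = 0 -> forall i, c i = 0) ->
  \sum_i pullback (prod_map (fst_map X X') (id_map Y)) (pullback (fst_map X Y) (a i)) *
          pullback (prod_map (snd_map X X') (id_map Y)) (m i) = 0 ->
  forall i, m i = 0.
Proof.
set q1 := prod_map (fst_map X X') _; set q2 := prod_map _ _ => ia am0 i1.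
apply: contrapT => /eqP m1.
have R : @generic k (prod_var (prod_var X X') Y) (fun w => exists z y,
    [/\ good z, good y, w = segre z y &
     \sum_i ev (a i) (rmap (fst_map X X') z) * ev (m i) (segre (rmap (snd_map X X') z) y) = 0]).
  have gY := @generic_good k Y; have gX := @generic_good k X.
  have gZ := generic_and (@generic_good k (prod_var X X'))
    (generic_and (generic_rmap (fst_map X X') gX)
                 (generic_rmap (snd_map X X') (@generic_good k X'))).
  have h1 := generic_allT (fun i => ev_pullback q1 (pullback (fst_map X Y) (a i))).
  have h2 := generic_allT (fun i => generic_rmap q1 (ev_pullback (fst_map X Y) (a i))).
  have h3 := generic_allT (fun i => ev_pullback q2 (m i)).
  have h4 := ev_sum (index_enum I) (fun i => pullback q1 (pullback (fst_map X Y) (a i)) *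
    pullback q2 (m i)).
  have h5 := generic_allT (fun i => evM (pullback q1 (pullback (fst_map X Y) (a i)))
    (pullback q2 (m i))).
  rewrite am0 in h4.
  apply: generic2 (generic_and (generic_segre gZ gY) (ev0 (prod_var (prod_var X X') Y)))
    (generic_and (generic_and h1 h2) (generic_and h3 (generic_and h4 h5))) _.
  move=> _ _ [[z [y [_ _ [gz [[_ gx] [_ gx']]] gy ->]]] e0] [[e1 e2] [e3 [e4 e5]]].
  exists z, y; split=> //; rewrite -[RHS]e0 e4; apply: eq_bigr => i _.
  rewrite e5 e1 (e2 i).2 e3; congr (_ * _); apply: ev_proj_eq; apply: proj_eq_sym.
    apply: proj_eq_trans (rmap_proj_eq _ (rmap_prod _ _ gz gy)) _.
    by rewrite rmap_id; apply: rmap_fst.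
  by have := rmap_prod (snd_map X X') (id_map Y) gz gy; rewrite rmap_id.
(* Freezes [y]. The factors recovered from [segre z y] differ from [z] and [y] by scalars, which
   [ev] ignores. *)
have R1 : @generic k Y (fun y => @generic k (prod_var X X') (fun z =>
    \sum_i ev (a i) (rmap (fst_map X X') z) * ev (m i) (segre (rmap (snd_map X X') z) y) = 0)).
  have gY := generic_fubini R.
  have [W [cW nW WP]] := gY; exists W; split=> // y Yy Wy.
  apply: genericW (WP y Yy Wy) => z Zz [z' [y' [_ _ e e0]]].
  have [c [d [c0 d0 -> ->]]] := segre_inj e (qpvar_neq0 Zz) (qpvar_neq0 Yy).
  rewrite -[RHS]e0; apply: eq_bigr => i _; congr (_ * _); apply: ev_proj_eq.
    by apply: rmap_proj_eq; apply: proj_eq_scale.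
  by apply: segre_proj_eq; [apply: rmap_proj_eq|]; apply: proj_eq_scale.
have [y Yy [Ry My]] := generic_exists (generic_and R1 (generic_fubini (ev_neq0 m1))).
(* Freezes [x']; the values [m_i(x', y)] are now the constants of the relation. *)
have [x' Xx' [[Rx' gx'] Mx']] :=
  generic_exists (generic_and (generic_and (generic_fubini Ry) (@generic_good k X')) My).
move/eqP: Mx'; apply; apply: (ia (fun i => ev (m i) (segre x' y))).
apply: ev_inj.
have h1 := generic_allT (fun i => ev_const X (ev (m i) (segre x' y))).
have h2 := generic_allT (fun i => evM (ratconst X (ev (m i) (segre x' y))) (a i)).
have h3 := ev_sum (index_enum I) (fun i => ratconst X (ev (m i) (segre x' y)) * a i).
apply: generic2 (generic_and (generic_and Rx' (@generic_good k X)) (ev0 X))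
  (generic_and (generic_and h1 h2) h3) _ => x _ [[Rx gx] ->] [[e1 e2] ->].
rewrite -[RHS]Rx; apply: eq_bigr => i _; rewrite e2 e1 mulrC.
congr (_ * _); apply: ev_proj_eq; apply: proj_eq_sym; first exact: rmap_fst.
by apply: segre_proj_eq; [apply: rmap_snd|apply: proj_eq_refl].
Qed.

End InvariantsOfProducts.

(** * Systems with only constant invariants *)

Section Invariants.
Variable k : closedFieldType.
Implicit Types (S T : ratdyn k) (X Y : qpvar k).

Definition only_constant_invariants S : Prop :=
  forall f, invariants S f -> exists c, f = ratconst (dvar S) c.

(** An invariant of [S] is one of the square through the first projection, and pullback is
    injective. *)
Lemma only_constant_invariants_square S :
  only_constant_invariants (prod_dyn S S) -> only_constant_invariants S.
Proof.
move=> SS a ia; pose X := dvar S.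
have [c ac] : exists c, pullback (fst_map X X) a = ratconst (prod_var X X) c.
  by apply: SS; rewrite /invariants /= pullback_prod_fst [pullback _ a]ia.
exists c; apply: (fmorph_inj (pullback (fst_map X X))).
by rewrite /= ac pullback_const.
Qed.

Lemma invariants_prod S T : only_constant_invariants (prod_dyn S S) ->
  invariants (prod_dyn S T) `<=` range (pullback (snd_map (dvar S) (dvar T))).
Proof.
move=> SS; have Sc := only_constant_invariants_square SS.
pose X := dvar S; pose Y := dvar T; pose phi := dmap S; pose psi := dmap T.
pose XY := prod_var X Y; pose XXY := prod_var (prod_var X X) Y.
pose s : {rmorphism ratfun XY -> ratfun XY} := pullback (prod_map phi (id_map Y)).
pose t : {rmorphism ratfun XY -> ratfun XY} := pullback (prod_map phi psi).
pose r : {rmorphism ratfun XXY -> ratfun XXY} :=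
  pullback (prod_map (prod_map phi phi) (id_map Y)).
pose p1 : {rmorphism ratfun XY -> ratfun XXY} := pullback (prod_map (fst_map X X) (id_map Y)).
pose p2 : {rmorphism ratfun XY -> ratfun XXY} := pullback (prod_map (snd_map X X) (id_map Y)).
pose K := range (pullback (fst_map X Y)); pose L := range (pullback (snd_map X Y)).
have sfst a : s (pullback (fst_map X Y) a) = pullback (fst_map X Y) (pullback phi a).
  exact: pullback_prod_fst.
have Kconst x : K x -> fixed s x -> exists c, x = ratconst XY c.
  move=> [a _ <-]; rewrite /fixed /= sfst => /fmorph_inj/Sc[c ->].
  by exists c; rewrite pullback_const.
apply: (@fixed_descent (ratfun XY) (ratfun XXY) s t r p1 p2 K L).
(* Both composites are [phi^2 x psi]. *)
- move=> x; apply: pullback_prod_comp; apply: genericT => z _; first exact: proj_eq_refl.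
  by rewrite !rmap_id; apply: proj_eq_refl.
- exact: subfield_range.
- exact: subfield_range.
- by move=> _ [a _ <-]; rewrite sfst; exists (pullback phi a).
- by move=> _ [a _ <-]; rewrite sfst /= pullback_prod_fst.
- by move=> _ [b _ <-]; rewrite /fixed /= /s /= pullback_prod_snd pullback_id.
- move=> x [Kx fx]; have [c ->] := Kconst x Kx fx.
  by exists (ratconst Y c); rewrite ?pullback_const.
- exact: compositum_prod.
- move=> x; apply: pullback_prod_comp; first exact: generic_rmap_fst_prod.
  by apply: genericT => y _; rewrite !rmap_id; apply: proj_eq_refl.
- move=> x; apply: pullback_prod_comp; first exact: generic_rmap_snd_prod.
  by apply: genericT => y _; rewrite !rmap_id; apply: proj_eq_refl.
- by move=> x Kx fx; have [c ->] := Kconst x Kx fx; rewrite /= !pullback_const.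
(* Constants are fixed by [s], so the [a i], seen as functions [a'] on [X], are independent over
   [k]. *)
- move=> I a m Ka ia am0.
  have [a' ha'] : {a' : I -> ratfun X & forall i, pullback (fst_map X Y) (a' i) = a i}.
    apply: (@choice _ _ (fun i x => pullback (fst_map X Y) x = a i)) => i.
    by have [x _ ?] := Ka i; exists x.
  apply: (pullback_prod_independent (X' := X) (a := a')) => [c ca0 i|].
    have : pullback (fst_map X Y) (ratconst X (c i)) = 0.
      apply: (ia (fun i => pullback (fst_map X Y) (ratconst X (c i)))) => [j|].
        split; first by exists (ratconst X (c j)).
        by rewrite /fixed /= sfst !pullback_const.
      rewrite -[RHS](rmorph0 (pullback (fst_map X Y))) -[X in _ = pullback _ X]ca0 rmorph_sum.
      by apply: eq_bigr => j _; rewrite rmorphM /= ha'.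
    by move=> /eqP; rewrite pullback_const fmorph_eq0 => /eqP.
  by rewrite -[RHS]am0; apply: eq_bigr => i _; rewrite ha'.
(* [fixed_prod_id] is applied to the square of [S], whose invariants are constant by hypothesis. *)
- move=> y ry; have [b _ <-] := fixed_prod_id SS ry.
  exists (pullback (snd_map X Y) b); first by exists b.
  by rewrite /= pullback_prod_snd pullback_id.
Qed.

Lemma invariants_snd S T b :
  invariants (prod_dyn S T) (pullback (snd_map (dvar S) (dvar T)) b) <-> invariants T b.
Proof.
rewrite /invariants /= pullback_prod_snd; split=> [/fmorph_inj//|h].
by rewrite [pullback _ b]h.
Qed.

Lemma only_constant_invariants_prod S T : only_constant_invariants (prod_dyn S S) ->
  only_constant_invariants T -> only_constant_invariants (prod_dyn S T).
Proof.
move=> SS cT f fi; have [b _ bf] := invariants_prod SS fi.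
rewrite -bf in fi *; have /cT[c ->] := (invariants_snd S b).1 fi.
by exists c; rewrite pullback_const.
Qed.

Lemma only_constant_invariants_power S n : only_constant_invariants (prod_dyn S S) ->
  only_constant_invariants (power_dyn S n).
Proof.
move=> SS; rewrite /power_dyn; elim: n.-1 => [|m IH] /=.
  exact: only_constant_invariants_square.
exact: only_constant_invariants_prod.
Qed.

Lemma adim_eq0 S : adim S = 0%N <-> only_constant_invariants S.
Proof. exact: trdeg_eq0 (coord_fun_generates (coordP (dvar S))). Qed.

Lemma adim_prod S T : only_constant_invariants (prod_dyn S S) ->
  adim (prod_dyn S T) = adim T.
Proof.
move=> SS; rewrite /adim.
have -> : invariants (prod_dyn S T) =
    pullback (snd_map (dvar S) (dvar T)) @` invariants T.
  apply/seteqP; split=> [f fi|_ [b bi <-]]; last exact/invariants_snd.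
  have [b _ bf] := invariants_prod SS fi; exists b => //.
  by apply/(invariants_snd S b); rewrite bf.
by apply: trdeg_image => c; apply: pullback_const.
Qed.

(** * The one-point system *)

Section Point.

(** This is [P^0]: all nonzero vectors of [k^1] represent its single point. *)
Definition point_points : set 'rV[k]_1 := [set x | x != 0].

Lemma rV1_proj_eq (x y : 'rV[k]_1) : x != 0 -> y != 0 -> proj_eq x y.
Proof.
move=> /rV_neq0P[i xi] /rV_neq0P[j yj]; rewrite !ord1 in xi yj.
exists (x 0 0 / y 0 0); first by rewrite mulf_neq0 ?invr_eq0.
by apply/rowP => l; rewrite mxE ord1 divfK.
Qed.

Lemma point_locally_closed : locally_closed point_points.
Proof.
exists point_points, set0; split; first exact: closedn0.
  apply/closedP; split=> // x _ _; exists 1, 0%N; split=> //; first exact: dhomog1.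
  by rewrite meval1 oner_neq0.
by rewrite setD0.
Qed.

Lemma point_irreducible : irreducible point_points.
Proof.
have p0 : point_points (const_mx 1).
  by apply/rV_neq0P; exists 0; rewrite mxE oner_neq0.
split; first by exists (const_mx 1).
have cover Z : zariski_closed Z -> Z (const_mx 1) -> point_points `<=` Z.
  move=> cZ Z1 x x0; have [c c0 ->] := rV1_proj_eq x0 p0.
  exact: closed_scale.
by move=> Z W cZ cW /(_ _ p0)[/(cover _ cZ)|/(cover _ cW)]; [left|right].
Qed.

Definition point_dyn : ratdyn k :=
  RatDyn (id_map (QPVar point_locally_closed point_irreducible)).

Lemma point_only_constant_invariants : only_constant_invariants point_dyn.
Proof.
move=> f _; set P := dvar point_dyn.
have [[x0 Px0] _] := points_irreducible P.
exists (ev f x0); apply: ev_inj; apply: genericW (ev_const P (ev f x0)) => x Px ->.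
by apply: ev_proj_eq; apply: rV1_proj_eq.
Qed.

End Point.

End Invariants.

Theorem corollaryB (k : closedFieldType) (S : ratdyn k) :
  ((exists T : ratdyn k, (0 < (adim (prod_dyn S T))%:Z - (adim T)%:Z)%R)
     <-> (0 < adim (prod_dyn S S))%N) /\
  ((exists n : nat, (1 <= n)%N /\
      exists f : ratfun (dvar (power_dyn S n)),
        invariants (power_dyn S n) f /\ nonconstant f)
     <-> (exists f : ratfun (dvar (prod_dyn S S)),
            invariants (prod_dyn S S) f /\ nonconstant f)).
Proof.
split; split.
- move=> [T]; rewrite Num.Theory.subr_gt0 ltz_nat lt0n; apply: contraTneq => /adim_eq0 SS.
  by rewrite adim_prod // ltnn.
(* If [adim S = 0], then [T = S] works. Otherwise [T] is the point, of [adim] 0, and a nonconstant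
   invariant of [S] pulls back to the product. *)
- move=> SS; have [S0|S0] := eqVneq (adim S) 0%N.
    by exists S; rewrite S0 subr0 ltz_nat.
  exists (point_dyn k); rewrite (adim_eq0 (point_dyn k)).2 ?subr0 ?ltz_nat; last first.
    exact: point_only_constant_invariants.
  rewrite lt0n; apply: contra_neq S0 => /adim_eq0 cSP; apply/adim_eq0 => f fi.
  pose u := fst_map (dvar S) (dvar (point_dyn k)).
  have [c fc] : exists c, pullback u f = ratconst _ c.
    by apply: cSP; rewrite /invariants /= pullback_prod_fst [pullback _ f]fi.
  exists c; apply: (fmorph_inj (pullback u)).
  by rewrite /= fc pullback_const.
- move=> [n [_ [f [fi fn]]]]; apply: contrapT => SS; apply: fn.
  apply: only_constant_invariants_power fi => g gi.
  by apply: contrapT => gn; apply: SS; exists g.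
(* [power_dyn S 2] reduces to [prod_dyn S S]. *)
- by move=> h; exists 2%N.
Qed.
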